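(* Let $x,\alpha,\beta\in\mathbb{C}$. Suppose that $\Re(x)>0$, or suppose that either one of $\alpha,\beta$ is an odd integer or $\alpha+\beta$ is an even integer. Then $$\frac{\Gamma\left(\frac12(x-\alpha+1)\right)\Gamma\left(\frac12(x+\alpha+\beta)\right)\Gamma\left(\frac12(x-\beta+1)\right)}{\Gamma\left(\frac12(x+\alpha+1)\right)\Gamma\left(\frac12(x-\alpha-\beta+2)\right)\Gamma\left(\frac12(x+\beta+1)\right)} =\cfrac{1}{x/2+\mathbf{K}_{m=1}^{\infty}\left(\frac{\kappa_m}{x}\right)},$$ where for every integer $m\ge1$ $$\kappa_{2m}=\frac{(2m-\alpha-\beta)(2m-1+\alpha)(2m-1+\beta)}{4(2m-1)},\qquad \kappa_{2m-1}=\frac{(2m-2+\alpha+\beta)(2m-1-\alpha)(2m-1-\beta)}{4(2m-1)}.$$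
   Context: For complex sequences $(a_n)_{n\ge1}$, $(b_n)_{n\ge0}$, the continued fraction $b_0+\mathbf{K}_{n=1}^{\infty}\left(\frac{a_n}{b_n}\right)=b_0+\cfrac{a_1}{b_1+\cfrac{a_2}{b_2+\cdots}}$ is defined as the limit as $n\to\infty$ of its $n$th approximant $b_0+\mathbf{K}_{k=1}^{n}\left(\frac{a_k}{b_k}\right)=b_0+\cfrac{a_1}{b_1+\cfrac{a_2}{\ddots+\cfrac{a_n}{b_n}}}$. The notation $\cfrac{a_0}{b_0+\mathbf{K}_{m=1}^{\infty}\left(\frac{a_m}{b_m}\right)}$ means $a_0$ divided by $b_0+\mathbf{K}_{m=1}^{\infty}\left(\frac{a_m}{b_m}\right)$. $\Gamma$ is the Gamma function. *)

(* Defs.v *)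
From Stdlib Require Import Reals Factorial.
From Coquelicot Require Import Coquelicot.

Open Scope R_scope.
Open Scope C_scope.

Definition Cexp (z : C) : C :=
  exp (Re z) * (cos (Im z), sin (Im z)).

(** [rising z n] = z (z + 1) ... (z + n - 1). *)
Fixpoint rising (z : C) (n : nat) : C :=
  match n with
  | O => 1
  | S n' => rising z n' * (z + INR n')
  end.

(** The Gamma function is given by the limit of Gauss,
      Gamma(z) = lim_n  n! n^z / (z (z + 1) ... (z + n)),
    valid for every complex z that is not one of the poles 0, -1, -2, ...
    At the poles the value of [Gamma] below is a meaningless default. *)
Definition Gauss_term (z : C) (n : nat) : C :=
  INR (fact n) * Cexp (z * ln (INR n)) / rising z (S n).

Definition Gamma (z : C) : C :=
  (real (Lim_seq (fun n => Re (Gauss_term z n))),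
   real (Lim_seq (fun n => Im (Gauss_term z n)))).

Definition Gamma_pole (z : C) : Prop := exists k : nat, z = - INR k.

(** The Riemann sphere. *)
Inductive sphere : Set :=
  | Fin : C -> sphere
  | Infty : sphere.

Definition sphere_locally (w : sphere) : (sphere -> Prop) -> Prop :=
  match w with
  | Fin z => fun P => locally z (fun y => P (Fin y))
  | Infty => fun P =>
      P Infty /\ exists M : R, forall y : C, (M < Cmod y)%R -> P (Fin y)
  end.

Definition sphere_add (b : C) (w : sphere) : sphere :=
  match w with
  | Fin z => Fin (b + z)
  | Infty => Infty
  end.

(** The quotient [a / w].  A zero numerator gives 0 whatever [w] is, 0
    included: a continued fraction stops at its first zero partial numerator. *)
Definition sphere_div (a : C) (w : sphere) : sphere :=
  if Ceq_dec a 0 then Fin 0 else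
  match w with
  | Fin z => if Ceq_dec z 0 then Infty else Fin (a / z)
  | Infty => Fin 0
  end.

(** [cf_K a b j n] = K_{k = j+1}^{j+n} (a_k / b_k). *)
Fixpoint cf_K (a b : nat -> C) (j n : nat) : sphere :=
  match n with
  | O => Fin 0
  | S n' => sphere_div (a (S j)) (sphere_add (b (S j)) (cf_K a b (S j) n'))
  end.

Definition cf_approximant (a b : nat -> C) (n : nat) : sphere :=
  sphere_add (b O) (cf_K a b O n).

Definition is_cf (a b : nat -> C) (w : sphere) : Prop :=
  filterlim (cf_approximant a b) eventually (sphere_locally w).

Definition odd_integer (z : C) : Prop := exists k : Z, z = IZR (2 * k + 1).

Definition even_integer (z : C) : Prop := exists k : Z, z = IZR (2 * k).

Definition Gamma_quotient (alpha beta x : C) : C :=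
  (Gamma ((x - alpha + 1) / 2) * Gamma ((x + alpha + beta) / 2)
     * Gamma ((x - beta + 1) / 2))
  / (Gamma ((x + alpha + 1) / 2) * Gamma ((x - alpha - beta + 2) / 2)
     * Gamma ((x + beta + 1) / 2)).

Definition Gamma_quotient_regular (alpha beta x : C) : Prop :=
  ~ Gamma_pole ((x - alpha + 1) / 2) /\
  ~ Gamma_pole ((x + alpha + beta) / 2) /\
  ~ Gamma_pole ((x - beta + 1) / 2) /\
  ~ Gamma_pole ((x + alpha + 1) / 2) /\
  ~ Gamma_pole ((x - alpha - beta + 2) / 2) /\
  ~ Gamma_pole ((x + beta + 1) / 2).

(** [v] is the value at [x] of the Gamma quotient, as a meromorphic function of
    [x] into the sphere.  The limit gives the value where some of the six Gamma
    factors have a pole, possibly cancelling; next to [x] there is no pole. *)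
Definition is_Gamma_quotient_value (alpha beta x : C) (v : sphere) : Prop :=
  (Gamma_quotient_regular alpha beta x -> v = Fin (Gamma_quotient alpha beta x))
  /\ filterlim (fun t : C => Fin (Gamma_quotient alpha beta t))
       (locally' x) (sphere_locally v).

(* Main.v *)
Require Import Defs.
From Stdlib Require Import Reals ZArith Lra Lia Classical.
From Coquelicot Require Import Coquelicot.

(** Put gamma = 1 - alpha - beta.  The coefficients are
    kappa_(2m-1) = (N - alpha)(N - beta)(N - gamma) / 4N and
    kappa_(2m) = (N + alpha)(N + beta)(N + gamma) / 4N with N = 2m - 1, and the
    reciprocal of the Gamma quotient is the product over d = alpha, beta, gamma
    of Gamma((1 + x + d)/2) / Gamma((1 + x - d)/2).  It is multiplied by the
    product of (1 + x + d)/(1 + x - d) when x is replaced by x + 2, and it is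
    asymptotic to x/2.  The value w(x) of the denominator
    x/2 + K(kappa_m / x) has the same two properties, and they determine it.

    The functional equation of w is a Bauer-Muir transformation.  There is an
    explicit modifying sequence r_n, close to (n - x)/2, for which
    kappa_(n+1) - r_n (x + r_(n+1)) does not depend on n ([modifier_defect]).
    The transformed recurrences at x and, reflected, at x + 2 coincide
    ([modifier_shift]).  Hence an explicit combination of three consecutive
    numerators at x is a numerator at x + 2, up to a factor, and likewise for
    denominators with another factor ([shifted_num], [shifted_den]).  The
    asymptotics of w come from the tails of the continued fraction, which stay
    in a half plane when Re x is large ([cf_near_half]).  Iterating the
    functional equation along x + 2n and comparing with Gauss's product gives
    the Gamma factors ([Gamma_factors]).

    The functional equation is used for a representation w = U/V in homogeneous
    coordinates, so that zeros and poles need no exception.  If some coefficient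
    vanishes, U and V are the numerator and the denominator just before the
    first such coefficient: these are polynomials in x, and the identity holds
    for all x.  An odd integer among alpha, beta, gamma leads to this case
    ([kappa_zero]), and that is what the parity conditions say.  Otherwise
    Re x > 0, and U and V are the limits of the numerators and denominators
    divided by the product of the (x + k)/2, 1 <= k <= n.  These limits exist
    because kappa_n = n(n-1)/4 + O(1): the recurrence is a summable perturbation
    of one with solutions growing like n^x and (-1)^n n^(-x) relative to n!/2^n
    ([oscillating_converges], [normalized_limits]).  They are not both 0 since
    the Casoratian is a product of nonzero coefficients.

    Near the given x the Gamma quotient is V/U again, and also the quotient of
    two products of the entire function 1/Gamma ([rgamma]).  In the first case
    U and V, in the second case these products, are continuous without common
    zero at x, so the limit on the sphere is the value of the continued
    fraction ([Gamma_quotient_value]). *)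

Local Open Scope C_scope.

(** * Limits of complex functions *)

(** The modulus as distance lets estimates apply directly; [locally_Cmod] is the
    link with neighbourhoods. *)
Definition tends {T : Type} (F : (T -> Prop) -> Prop) (f : T -> C) (l : C) : Prop :=
  forall eps : R, (0 < eps)%R -> F (fun t => (Cmod (f t - l) < eps)%R).

Lemma Cmod_sub_comm (u v : C) : Cmod (u - v) = Cmod (v - u).
Proof. rewrite <- Cmod_opp. f_equal. ring. Qed.

Lemma Cmod_sub_triangle (u v w : C) : (Cmod (u - w) <= Cmod (u - v) + Cmod (v - w))%R.
Proof.
  replace (u - w) with ((u - v) + (v - w)) by ring. apply Cmod_triangle.
Qed.

Lemma Cmod_triangle_rev (u v : C) : (Cmod u - Cmod v <= Cmod (u - v))%R.
Proof.
  pose proof (Cmod_triangle (u - v) v) as H.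
  replace (u - v + v) with u in H by ring. lra.
Qed.

Lemma Cmod_INR (n : nat) : Cmod (INR n) = INR n.
Proof. rewrite Cmod_R. apply Rabs_pos_eq, pos_INR. Qed.

Lemma Im_le_Cmod (z : C) : (Rabs (Im z) <= Cmod z)%R.
Proof.
  eapply Rle_trans; [ | apply Rmax_Cmod]. apply Rmax_r.
Qed.

Lemma Cmod_le_Re_Im (z : C) : (Cmod z <= Rabs (Re z) + Rabs (Im z))%R.
Proof.
  destruct z as [u v]; simpl.
  replace (u, v) with (RtoC u + Ci * RtoC v).
  - eapply Rle_trans; [apply Cmod_triangle | ].
    rewrite Cmod_mult, Cmod_Ci, !Cmod_R. lra.
  - apply injective_projections; simpl; ring.
Qed.

Lemma Cmult_neq_0 (u v : C) : u <> 0 -> v <> 0 -> u * v <> 0.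
Proof.
  intros Hu Hv. apply Cmod_gt_0. rewrite Cmod_mult.
  apply Rmult_lt_0_compat; now apply Cmod_gt_0.
Qed.

Lemma Cmult_eq_0 (u v : C) : u * v = 0 -> u = 0 \/ v = 0.
Proof.
  intros H. destruct (Ceq_dec u 0) as [|Hu]; [now left|].
  destruct (Ceq_dec v 0) as [|Hv]; [now right|].
  now destruct (Cmult_neq_0 u v Hu Hv).
Qed.

Lemma Cmult_cancel_l (u v w : C) : u <> 0 -> u * v = u * w -> v = w.
Proof.
  intros Hu H. replace v with (/ u * (u * v)) by (field; exact Hu).
  rewrite H. field. exact Hu.
Qed.

Section Tends.

Context {T : Type} {F : (T -> Prop) -> Prop} {FF : Filter F}.

Lemma tends_ext_loc (f g : T -> C) (l : C) :
  F (fun t => f t = g t) -> tends F f l -> tends F g l.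
Proof.
  intros He H eps Heps. specialize (H eps Heps).
  eapply filter_imp; [ | exact (filter_and _ _ He H)].
  intros t [E L]. now rewrite <- E.
Qed.

Lemma tends_ext (f g : T -> C) (l : C) :
  (forall t, f t = g t) -> tends F f l -> tends F g l.
Proof. intros He. apply tends_ext_loc. now apply filter_forall. Qed.

Lemma tends_const (c : C) : tends F (fun _ => c) c.
Proof.
  intros eps Heps. apply filter_forall. intros _.
  replace (c - c) with (RtoC 0) by ring. now rewrite Cmod_0.
Qed.

Lemma tends_plus (f g : T -> C) (a b : C) :
  tends F f a -> tends F g b -> tends F (fun t => f t + g t) (a + b).
Proof.
  intros Hf Hg eps Heps. assert (He : (0 < eps / 2)%R) by lra.
  eapply filter_imp; [ | exact (filter_and _ _ (Hf _ He) (Hg _ He))].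
  intros t [H1 H2]. cbv beta in *.
  replace (f t + g t - (a + b)) with ((f t - a) + (g t - b)) by ring.
  eapply Rle_lt_trans; [apply Cmod_triangle | lra].
Qed.

Lemma tends_opp (f : T -> C) (a : C) :
  tends F f a -> tends F (fun t => - f t) (- a).
Proof.
  intros Hf eps Heps. eapply filter_imp; [ | exact (Hf eps Heps)].
  intros t Ht. cbv beta in *. replace (- f t - - a) with (- (f t - a)) by ring.
  now rewrite Cmod_opp.
Qed.

Lemma tends_minus (f g : T -> C) (a b : C) :
  tends F f a -> tends F g b -> tends F (fun t => f t - g t) (a - b).
Proof. intros Hf Hg. apply tends_plus; [exact Hf | now apply tends_opp]. Qed.

Lemma tends_bounded (f : T -> C) (a : C) :
  tends F f a -> F (fun t => (Cmod (f t) < Cmod a + 1)%R).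
Proof.
  intros Hf. eapply filter_imp; [ | exact (Hf 1%R Rlt_0_1)].
  intros t Ht. pose proof (Cmod_triangle_rev (f t) a). cbv beta in *. lra.
Qed.

Lemma tends_mult (f g : T -> C) (a b : C) :
  tends F f a -> tends F g b -> tends F (fun t => f t * g t) (a * b).
Proof.
  intros Hf Hg eps Heps.
  pose proof (Cmod_ge_0 a) as Ha. pose proof (Cmod_ge_0 b) as Hb.
  set (e1 := (eps / 2 / (Cmod b + 1))%R).
  set (e2 := (eps / 2 / (Cmod a + 1))%R).
  assert (H1 : (0 < e1)%R) by (apply Rdiv_lt_0_compat; lra).
  assert (H2 : (0 < e2)%R) by (apply Rdiv_lt_0_compat; lra).
  eapply filter_imp;
    [ | exact (filter_and _ _ (Hf e1 H1) (filter_and _ _ (Hg e2 H2) (tends_bounded f a Hf)))].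
  intros t [L1 [L2 L3]]. cbv beta in *.
  replace (f t * g t - a * b) with (f t * (g t - b) + b * (f t - a)) by ring.
  eapply Rle_lt_trans; [apply Cmod_triangle | ]. rewrite !Cmod_mult.
  assert (E1 : ((Cmod b + 1) * e1 = eps / 2)%R) by (unfold e1; field; lra).
  assert (E2 : ((Cmod a + 1) * e2 = eps / 2)%R) by (unfold e2; field; lra).
  pose proof (Cmod_ge_0 (f t)). pose proof (Cmod_ge_0 (g t - b)).
  pose proof (Cmod_ge_0 (f t - a)). nra.
Qed.

Lemma tends_inv (f : T -> C) (a : C) :
  a <> 0 -> tends F f a -> tends F (fun t => / f t) (/ a).
Proof.
  intros Ha Hf eps Heps. assert (Hm : (0 < Cmod a)%R) by now apply Cmod_gt_0.
  set (e := Rmin (Cmod a / 2) (eps * (Cmod a * Cmod a) / 2)).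
  assert (He : (0 < e)%R).
  { apply Rmin_glb_lt; [lra | ]. apply Rdiv_lt_0_compat; [ | lra].
    repeat apply Rmult_lt_0_compat; lra. }
  eapply filter_imp; [ | exact (Hf e He)]. intros t Ht. cbv beta in *.
  pose proof (Rmin_l (Cmod a / 2) (eps * (Cmod a * Cmod a) / 2)) as M1.
  pose proof (Rmin_r (Cmod a / 2) (eps * (Cmod a * Cmod a) / 2)) as M2.
  fold e in M1, M2.
  assert (Hft : (Cmod a / 2 < Cmod (f t))%R).
  { pose proof (Cmod_triangle_rev a (f t)) as R. rewrite Cmod_sub_comm in R. lra. }
  assert (Hf0 : f t <> 0) by (apply Cmod_gt_0; lra).
  replace (/ f t - / a) with ((a - f t) / (f t * a)) by (field; auto).
  rewrite Cmod_div, Cmod_mult by now apply Cmult_neq_0.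
  rewrite Cmod_sub_comm. apply Rlt_div_l; nra.
Qed.

Lemma tends_div (f g : T -> C) (a b : C) :
  b <> 0 -> tends F f a -> tends F g b -> tends F (fun t => f t / g t) (a / b).
Proof. intros Hb Hf Hg. apply tends_mult; [exact Hf | now apply tends_inv]. Qed.

Lemma tends_neq_0 (f : T -> C) (a : C) :
  a <> 0 -> tends F f a -> F (fun t => f t <> 0).
Proof.
  intros Ha Hf. eapply filter_imp; [ | exact (Hf (Cmod a) (proj1 (Cmod_gt_0 a) Ha))].
  intros t Ht E. cbv beta in *. rewrite E in Ht.
  replace (0 - a) with (- a) in Ht by ring. rewrite Cmod_opp in Ht. lra.
Qed.

End Tends.

Lemma tends_le {T : Type} (F G : (T -> Prop) -> Prop) (f : T -> C) (l : C) :
  filter_le G F -> tends F f l -> tends G f l.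
Proof. intros HG H eps Heps. now apply HG, H. Qed.

Section TendsProper.

Context {T : Type} {F : (T -> Prop) -> Prop} {FF : ProperFilter F}.

Lemma tends_unique (f : T -> C) (a b : C) : tends F f a -> tends F f b -> a = b.
Proof.
  intros Ha Hb. destruct (Ceq_dec (a - b) 0) as [E|N].
  { replace a with (a - b + b) by ring. rewrite E. ring. }
  exfalso. apply Cmod_gt_0 in N. assert (He : (0 < Cmod (a - b) / 2)%R) by lra.
  destruct (filter_ex _ (filter_and _ _ (Ha _ He) (Hb _ He))) as [t [H1 H2]].
  pose proof (Cmod_sub_triangle a (f t) b) as H3.
  rewrite (Cmod_sub_comm a (f t)) in H3. lra.
Qed.

Lemma tends_Cmod_le (f g : T -> C) (a b : C) (c : R) :
  tends F f a -> tends F g b -> (0 <= c)%R ->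
  F (fun t => (Cmod (f t) <= c * Cmod (g t))%R) -> (Cmod a <= c * Cmod b)%R.
Proof.
  intros Hf Hg Hc H. apply Rnot_lt_le. intros L.
  set (d := (Cmod a - c * Cmod b)%R).
  set (e := (d / (2 * (1 + c)))%R).
  assert (He : (0 < e)%R) by (apply Rdiv_lt_0_compat; unfold d; lra).
  destruct (filter_ex _ (filter_and _ _ H (filter_and _ _ (Hf e He) (Hg e He))))
    as [t [H1 [H2 H3]]].
  pose proof (Cmod_triangle_rev a (f t)) as H4. rewrite Cmod_sub_comm in H4.
  pose proof (Cmod_triangle_rev (g t) b) as H5.
  assert (E : (e * (1 + c) = d / 2)%R) by (unfold e; field; lra).
  assert (d = (Cmod a - c * Cmod b)%R) by reflexivity. nra.
Qed.

End TendsProper.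

Lemma tends_shift (u : nat -> C) (l : C) (k : nat) :
  tends eventually u l -> tends eventually (fun n => u (n + k)%nat) l.
Proof.
  intros H eps Heps. destruct (H eps Heps) as [N HN].
  exists N. intros n Hn. apply HN. lia.
Qed.

Lemma tends_unshift (u : nat -> C) (l : C) (k : nat) :
  tends eventually (fun n => u (n + k)%nat) l -> tends eventually u l.
Proof.
  intros H eps Heps. destruct (H eps Heps) as [N HN].
  exists (N + k)%nat. intros n Hn. replace n with (n - k + k)%nat by lia. apply HN. lia.
Qed.

Lemma tends_squeeze (u : nat -> C) (l : C) (r : nat -> R) :
  is_lim_seq r 0 -> eventually (fun n => (Cmod (u n - l) <= r n)%R) -> tends eventually u l.
Proof.
  intros Hr Hu eps Heps. apply is_lim_seq_spec in Hr.
  pose proof (Hr (mkposreal eps Heps)) as H. simpl in H.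
  eapply filter_imp; [ | exact (filter_and _ _ Hu H)].
  intros n [H1 H2]. cbv beta in *. rewrite Rminus_0_r in H2.
  apply Rabs_lt_between in H2. lra.
Qed.

Lemma scaled_inverse_tends_0 (M : R) : is_lim_seq (fun n => (M * / INR n)%R) 0.
Proof.
  replace (Finite 0) with (Rbar_mult M 0) by (simpl; f_equal; ring).
  apply is_lim_seq_scal_l. replace (Finite 0) with (Rbar_inv p_infty) by reflexivity.
  apply is_lim_seq_inv; [apply is_lim_seq_INR | discriminate].
Qed.

Lemma locally_Cmod (z : C) (P : C -> Prop) :
  locally z P <-> exists eps : R, (0 < eps)%R /\ forall y, (Cmod (y - z) < eps)%R -> P y.
Proof.
  split.
  - intros [eps H]. exists eps. split; [apply cond_pos | ].
    intros y Hy. apply H, C_NormedModule_mixin_compat1. exact Hy.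
  - intros [eps [Heps H]].
    assert (H2 : (0 < sqrt 2)%R) by (apply sqrt_lt_R0; lra).
    assert (He : (0 < eps / sqrt 2)%R) by now apply Rdiv_lt_0_compat.
    exists (mkposreal _ He). intros y Hy. apply H.
    apply C_NormedModule_mixin_compat2 in Hy. simpl in Hy.
    eapply Rlt_le_trans; [exact Hy | ]. right. field. lra.
Qed.

Lemma tends_id (z : C) : tends (locally z) (fun t => t) z.
Proof. intros eps Heps. apply locally_Cmod. exists eps. now split. Qed.

Lemma locally'_Cmod (z : C) (P : C -> Prop) :
  locally' z P <->
  exists eps : R, (0 < eps)%R /\ forall y, (Cmod (y - z) < eps)%R -> y <> z -> P y.
Proof. unfold locally', within. apply locally_Cmod. Qed.

(** The limit as a total function of the sequence, by real and imaginary parts: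
    the form in which [Gamma] is given. *)
Definition climit (u : nat -> C) : C :=
  (real (Lim_seq (fun n => Re (u n))), real (Lim_seq (fun n => Im (u n)))).

Lemma tends_climit (u : nat -> C) (l : C) : tends eventually u l -> climit u = l.
Proof.
  intros H. unfold climit. destruct l as [a b].
  assert (Ha : is_lim_seq (fun n => Re (u n)) a).
  { apply is_lim_seq_spec. intros eps.
    eapply filter_imp; [ | exact (H eps (cond_pos eps))]. intros n Hn. cbv beta in *.
    eapply Rle_lt_trans; [ | exact Hn].
    exact (re_le_Cmod (u n - (a, b))). }
  assert (Hb : is_lim_seq (fun n => Im (u n)) b).
  { apply is_lim_seq_spec. intros eps.
    eapply filter_imp; [ | exact (H eps (cond_pos eps))]. intros n Hn. cbv beta in *.
    eapply Rle_lt_trans; [ | exact Hn].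
    exact (Im_le_Cmod (u n - (a, b))). }
  now rewrite (is_lim_seq_unique _ _ Ha), (is_lim_seq_unique _ _ Hb).
Qed.

(** A sequence whose steps are bounded by the decrease of a nonnegative real
    sequence is Cauchy.  All infinite products and sums below converge by this,
    with the value of the real sequence as an error bound. *)
Lemma telescoping_converges (p : nat -> C) (q : nat -> R) (N : nat) :
  (forall n, (N <= n)%nat -> (0 <= q n)%R) ->
  (forall n, (N <= n)%nat -> (Cmod (p (S n) - p n) <= q n - q (S n))%R) ->
  exists l, tends eventually p l /\
    forall n, (N <= n)%nat -> (Cmod (p n - l) <= q n)%R.
Proof.
  intros Hq Hp.
  assert (Hsteps : forall n k, (N <= n)%nat ->
            (Cmod (p (k + n)%nat - p n) <= q n - q (k + n)%nat)%R).
  { intros n k Hn. induction k as [|k IH]; simpl.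
    - replace (p n - p n) with (RtoC 0) by ring. rewrite Cmod_0. lra.
    - pose proof (Cmod_sub_triangle (p (S (k + n))) (p (k + n)%nat) (p n)).
      pose proof (Hp (k + n)%nat ltac:(lia)). lra. }
  assert (Hdec : forall n, (q (S (n + N)) <= q (n + N)%nat)%R).
  { intros n. pose proof (Hp (n + N)%nat ltac:(lia)).
    pose proof (Cmod_ge_0 (p (S (n + N)) - p (n + N)%nat)). lra. }
  assert (Hqc : ex_finite_lim_seq (fun n => q (n + N)%nat)).
  { apply ex_finite_lim_seq_decr with 0%R; [exact Hdec | ].
    intros n. apply Hq. lia. }
  assert (Hcauchy : forall eps : posreal, exists M : nat, forall n m, (M <= n)%nat ->
            (M <= m)%nat -> (Cmod (p n - p m) < eps)%R).
  { intros eps. destruct (proj1 (ex_lim_seq_cauchy_corr _) Hqc eps) as [M HM].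
    exists (M + N)%nat.
    assert (Hw : forall n m, (M + N <= m)%nat -> (m <= n)%nat -> (Cmod (p n - p m) < eps)%R).
    { intros n m Hm Hnm.
      pose proof (Hsteps m (n - m)%nat ltac:(lia)) as H1.
      replace (n - m + m)%nat with n in H1 by lia.
      pose proof (HM (m - N)%nat (n - N)%nat ltac:(lia) ltac:(lia)) as H2.
      replace (m - N + N)%nat with m in H2 by lia.
      replace (n - N + N)%nat with n in H2 by lia.
      apply Rabs_lt_between in H2. lra. }
    intros n m Hn Hm. destruct (Nat.le_ge_cases m n) as [L|L].
    - now apply Hw.
    - rewrite Cmod_sub_comm. now apply Hw. }
  assert (Hre : ex_finite_lim_seq (fun n => Re (p n))).
  { apply ex_lim_seq_cauchy_corr. intros eps. destruct (Hcauchy eps) as [M HM].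
    exists M. intros n m Hn Hm. eapply Rle_lt_trans; [ | exact (HM n m Hn Hm)].
    exact (re_le_Cmod (p n - p m)). }
  assert (Him : ex_finite_lim_seq (fun n => Im (p n))).
  { apply ex_lim_seq_cauchy_corr. intros eps. destruct (Hcauchy eps) as [M HM].
    exists M. intros n m Hn Hm. eapply Rle_lt_trans; [ | exact (HM n m Hn Hm)].
    exact (Im_le_Cmod (p n - p m)). }
  destruct Hre as [a Ha]. destruct Him as [b Hb].
  assert (Hl : tends eventually p (a, b)).
  { intros eps Heps. apply is_lim_seq_spec in Ha, Hb.
    assert (He : (0 < eps / 2)%R) by lra.
    eapply filter_imp;
      [ | exact (filter_and _ _ (Ha (mkposreal _ He)) (Hb (mkposreal _ He)))].
    intros n [H1 H2]. simpl in H1, H2.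
    eapply Rle_lt_trans; [apply Cmod_le_Re_Im | ].
    change (Re (p n - (a, b))) with (Re (p n) - a)%R.
    change (Im (p n - (a, b))) with (Im (p n) - b)%R. lra. }
  exists (a, b). split; [exact Hl | ].
  intros n Hn. apply le_epsilon. intros eps Heps.
  destruct (Hl eps Heps) as [M HM].
  specialize (HM (M + n)%nat ltac:(lia)). cbv beta in HM.
  pose proof (Hsteps n M Hn) as H1.
  pose proof (Hq (M + n)%nat ltac:(lia)) as H2.
  pose proof (Cmod_sub_triangle (p n) (p (M + n)%nat) (a, b)) as H3.
  rewrite (Cmod_sub_comm (p n) (p (M + n)%nat)) in H3. lra.
Qed.

(** Harmless growth: a factor 1 + c/n^2 at each step multiplies a nonnegative
    sequence at most by 2 altogether, because (1 + c/n^2)(1 + 2c/n) is at most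
    1 + 2c/(n-1). *)
Lemma slow_growth (v : nat -> R) (c : R) (N : nat) :
  (0 <= c)%R -> (2 * c + 1 <= INR N)%R ->
  (forall n, (N <= n)%nat -> (0 <= v n)%R) ->
  (forall n, (N <= n)%nat -> (v (S n) <= (1 + c / (INR n * INR (S n))) * v n)%R) ->
  forall n, (N <= n)%nat -> (v n <= 2 * v N)%R.
Proof.
  intros Hc HN Hv Hs.
  set (w := fun n => ((1 + 2 * c / INR n) * v n)%R).
  assert (Hw : forall n, (N <= n)%nat -> (w n <= w N)%R).
  { intros n Hn. induction Hn as [|n Hn IH]; [lra | ].
    eapply Rle_trans; [ | exact IH]. unfold w.
    assert (H1 : (INR N <= INR n)%R) by now apply le_INR.
    pose proof (Hs n Hn) as H2. pose proof (Hv n Hn) as H3.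
    rewrite S_INR in *.
    assert (H4 : (0 <= 2 * c / (INR n + 1))%R).
    { apply Rdiv_le_0_compat; lra. }
    assert (H5 : ((1 + 2 * c / (INR n + 1)) * (1 + c / (INR n * (INR n + 1)))
                  <= 1 + 2 * c / INR n)%R).
    { apply Rminus_le.
      replace ((1 + 2 * c / (INR n + 1)) * (1 + c / (INR n * (INR n + 1)))
               - (1 + 2 * c / INR n))%R
        with (- (c * (INR n + 1 - 2 * c)) / (INR n * (INR n + 1) * (INR n + 1)))%R
        by (field; lra).
      apply Rmult_le_reg_r with (INR n * (INR n + 1) * (INR n + 1))%R.
      - repeat apply Rmult_lt_0_compat; lra.
      - unfold Rdiv. rewrite Rmult_assoc, Rinv_l.
        + nra.
        + apply Rgt_not_eq. repeat apply Rmult_lt_0_compat; lra. }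
    nra. }
  intros n Hn. pose proof (Hw n Hn) as H. unfold w in H.
  assert (H1 : (INR N <= INR n)%R) by now apply le_INR.
  pose proof (Hv n Hn). pose proof (Hv N (Nat.le_refl N)).
  assert (H4 : (0 <= 2 * c / INR n)%R) by (apply Rdiv_le_0_compat; lra).
  assert (H3 : (2 * c / INR N <= 1)%R) by (apply Rle_div_l; lra).
  nra.
Qed.

Lemma inv_INR_step (n : nat) : (1 <= n)%nat ->
  (1 / (INR n * INR (S n)) = 1 / INR n - 1 / INR (S n))%R.
Proof.
  intros Hn. apply le_INR in Hn. simpl in Hn. rewrite S_INR. field. lra.
Qed.

(** An infinite product with factors 1 + O(1/n^2).  The error bound is uniform
    in any parameter that [c] and [g N] do not depend on; it is relative to
    [g N], so that a nonzero [g N] excludes the limit 0. *)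
Lemma slow_product (g : nat -> C) (c : R) (N : nat) :
  (0 <= c)%R -> (2 * c + 1 <= INR N)%R ->
  (forall n, (N <= n)%nat ->
     (Cmod (g (S n) - g n) <= c / (INR n * INR (S n)) * Cmod (g n))%R) ->
  exists l, tends eventually g l /\
    forall n, (N <= n)%nat -> (Cmod (g n - l) <= 2 * c * Cmod (g N) / INR n)%R.
Proof.
  intros Hc HN Hg.
  assert (HN1 : (1 <= N)%nat) by (apply INR_le; simpl; lra).
  assert (Hb : forall n, (N <= n)%nat -> (Cmod (g n) <= 2 * Cmod (g N))%R).
  { apply slow_growth with (v := fun n => Cmod (g n)) (c := c); auto.
    - intros n _. apply Cmod_ge_0.
    - intros n Hn. pose proof (Hg n Hn) as H.
      pose proof (Cmod_triangle_rev (g (S n)) (g n)). lra. }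
  apply telescoping_converges with (q := fun n => (2 * c * Cmod (g N) / INR n)%R).
  - intros n Hn. apply le_INR in Hn. pose proof (Cmod_ge_0 (g N)).
    apply Rdiv_le_0_compat; [ | lra]. apply Rmult_le_pos; lra.
  - intros n Hn. eapply Rle_trans; [now apply Hg | ].
    replace (2 * c * Cmod (g N) / INR n - 2 * c * Cmod (g N) / INR (S n))%R
      with (c * (1 / INR n - 1 / INR (S n)) * (2 * Cmod (g N)))%R by (unfold Rdiv; ring).
    rewrite <- inv_INR_step by lia.
    assert (H1 : (0 < INR n)%R) by (apply lt_0_INR; lia).
    assert (H2 : (0 < INR (S n))%R) by (apply lt_0_INR; lia).
    replace (c * (1 / (INR n * INR (S n))))%R with (c / (INR n * INR (S n)))%R
      by (field; lra).
    apply Rmult_le_compat_l; [ | now apply Hb].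
    apply Rdiv_le_0_compat; [lra | now apply Rmult_lt_0_compat].
Qed.

(** * The reciprocal of the Gamma function *)

Lemma Cexp_plus (u v : C) : Cexp (u + v) = Cexp u * Cexp v.
Proof.
  unfold Cexp. change (Re (u + v)) with (Re u + Re v)%R.
  change (Im (u + v)) with (Im u + Im v)%R.
  rewrite exp_plus, cos_plus, sin_plus.
  apply injective_projections; simpl; ring.
Qed.

Lemma Cexp_RtoC (r : R) : Cexp r = exp r.
Proof.
  unfold Cexp. simpl. rewrite cos_0, sin_0. apply injective_projections; simpl; ring.
Qed.

Lemma Cexp_neq_0 (u : C) : Cexp u <> 0.
Proof.
  intros H. assert (E : Cexp u * Cexp (- u) = 1).
  { rewrite <- Cexp_plus. replace (u + - u) with (RtoC 0) by ring.
    now rewrite Cexp_RtoC, exp_0. }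
  rewrite H in E. apply C1_nz. rewrite <- E. ring.
Qed.

Lemma Cexp_opp (u : C) : Cexp (- u) = / Cexp u.
Proof.
  apply (Cmult_cancel_l (Cexp u)); [apply Cexp_neq_0 | ].
  rewrite <- Cexp_plus, Cinv_r by apply Cexp_neq_0.
  replace (u + - u) with (RtoC 0) by ring. now rewrite Cexp_RtoC, exp_0.
Qed.

Lemma exp_Taylor_1 (a : R) :
  (Rabs a <= / 2)%R -> (Rabs (exp a - 1 - a) <= 2 * (a * a))%R.
Proof.
  intros Ha. apply Rabs_le_between in Ha.
  pose proof (exp_ineq1_le a) as H1. pose proof (exp_ineq1_le (- a)) as H2.
  assert (H3 : (exp a * exp (- a) = 1)%R).
  { rewrite <- exp_plus, <- exp_0. f_equal. ring. }
  pose proof (exp_pos a) as H4. pose proof (exp_pos (- a)) as H5.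
  apply Rabs_le. split; [nra | ].
  assert (H6 : (exp a * (1 - a) <= 1)%R) by nra.
  assert (H7 : ((exp a - 1 - a) * (1 - a) <= a * a)%R) by nra.
  nra.
Qed.

Lemma sin_le_Rabs (b : R) : (Rabs (sin b) <= Rabs b)%R.
Proof.
  destruct (MVT_abs sin cos 0 b) as [c [Hc _]].
  { intros c _. apply derivable_pt_lim_sin. }
  rewrite sin_0, !Rminus_0_r in Hc. rewrite Hc.
  pose proof (COS_bound c) as Hb. pose proof (Rabs_pos b).
  assert (Rabs (cos c) <= 1)%R by (apply Rabs_le; lra). nra.
Qed.

Lemma cos_Taylor_0 (b : R) : (Rabs (cos b - 1) <= b * b / 2)%R.
Proof.
  replace (cos b - 1)%R with (- (2 * (sin (b / 2) * sin (b / 2))))%R.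
  - rewrite Rabs_Ropp, Rabs_pos_eq by (pose proof (Rle_0_sqr (sin (b / 2))); unfold Rsqr in *; lra).
    pose proof (Rsqr_le_abs_1 _ _ (sin_le_Rabs (b / 2))) as H. unfold Rsqr in H. lra.
  - replace b with (2 * (b / 2))%R at 3 by field. rewrite cos_2a_sin. ring.
Qed.

Lemma sin_Taylor_1 (b : R) : (Rabs b <= 1)%R -> (Rabs (sin b - b) <= b * b)%R.
Proof.
  intros Hb1.
  destruct (MVT_abs (fun t => sin t - t)%R (fun t => cos t - 1)%R 0 b) as [c [Hc Hcb]].
  { intros c _. apply derivable_pt_lim_minus; [apply derivable_pt_lim_sin | ].
    apply derivable_pt_lim_id. }
  rewrite sin_0, !Rminus_0_r in Hc. rewrite Hc.
  pose proof (cos_Taylor_0 c) as H.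
  assert (Habs : (Rabs c <= Rabs b)%R).
  { unfold Rmin, Rmax in Hcb. destruct (Rle_dec 0 b).
    - rewrite !Rabs_pos_eq; lra.
    - rewrite !Rabs_left1; lra. }
  pose proof (Rsqr_le_abs_1 _ _ Habs) as H2. unfold Rsqr in H2.
  assert (E : (b * b = Rabs b * Rabs b)%R) by (rewrite <- Rabs_mult, Rabs_pos_eq; nra).
  pose proof (Rabs_pos b). nra.
Qed.

Lemma Cexp_Taylor_1 (u : C) :
  (Cmod u <= / 2)%R -> (Cmod (Cexp u - 1 - u) <= 14 * (Cmod u * Cmod u))%R.
Proof.
  intros Hu. destruct u as [a b].
  pose proof (re_le_Cmod (a, b)) as Ha. pose proof (Im_le_Cmod (a, b)) as Hb. simpl in Ha, Hb.
  set (m := Cmod (a, b)) in *.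
  eapply Rle_trans; [apply Cmod_le_Re_Im | ].
  replace (Re (Cexp (a, b) - 1 - (a, b))) with ((exp a - 1 - a) + exp a * (cos b - 1))%R
    by (simpl; ring).
  replace (Im (Cexp (a, b) - 1 - (a, b)))
    with (exp a * (sin b - b) + ((exp a - 1 - a) + a) * b)%R by (simpl; ring).
  pose proof (exp_Taylor_1 a ltac:(lra)) as H1.
  pose proof (cos_Taylor_0 b) as H2. pose proof (sin_Taylor_1 b ltac:(lra)) as H3.
  assert (H4 : (0 < exp a <= 3)%R).
  { split; [apply exp_pos | ]. apply Rle_trans with (exp 1); [ | apply exp_le_3].
    apply Rabs_le_between in Ha. destruct (Req_dec a 1); [subst; lra | ].
    left. apply exp_increasing. lra. }
  assert (Ea : (a * a = Rabs a * Rabs a)%R) by (rewrite <- Rabs_mult, Rabs_pos_eq; nra).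
  assert (Eb : (b * b = Rabs b * Rabs b)%R) by (rewrite <- Rabs_mult, Rabs_pos_eq; nra).
  pose proof (Rabs_pos a) as Pa. pose proof (Rabs_pos b) as Pb.
  rewrite Ea in H1. rewrite Eb in H2, H3.
  assert (Qa : (Rabs a * Rabs a <= m * m)%R) by nra.
  assert (Qb : (Rabs b * Rabs b <= m * m)%R) by nra.
  assert (B1 : (Rabs (exp a * (cos b - 1)) <= 3 * (m * m / 2))%R).
  { rewrite Rabs_mult, (Rabs_pos_eq (exp a)) by lra.
    apply Rmult_le_compat; try lra. apply Rabs_pos. }
  assert (B2 : (Rabs (exp a * (sin b - b)) <= 3 * (m * m))%R).
  { rewrite Rabs_mult, (Rabs_pos_eq (exp a)) by lra.
    apply Rmult_le_compat; try lra. apply Rabs_pos. }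
  assert (B3 : (Rabs ((exp a - 1 - a + a) * b) <= 3 * (m * m))%R).
  { rewrite Rabs_mult.
    pose proof (Rabs_triang (exp a - 1 - a) a) as H5.
    apply Rle_trans with (2 * m * m)%R; [ | nra].
    apply Rmult_le_compat; try apply Rabs_pos; try lra. nra. }
  pose proof (Rabs_triang (exp a - 1 - a) (exp a * (cos b - 1))) as T1.
  pose proof (Rabs_triang (exp a * (sin b - b)) ((exp a - 1 - a + a) * b)) as T2.
  nra.
Qed.

Lemma ln_le_sub_1 (y : R) : (0 < y)%R -> (ln y <= y - 1)%R.
Proof.
  intros Hy. pose proof (exp_ineq1_le (ln y)) as H. rewrite exp_ln in H by exact Hy. lra.
Qed.

Lemma ln_step (n : nat) : (1 <= n)%nat ->
  (/ INR (S n) <= ln (INR (S n)) - ln (INR n) <= / INR n)%R.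
Proof.
  intros Hn. assert (H1 : (0 < INR n)%R) by (apply lt_0_INR; lia).
  assert (H2 : (0 < INR (S n))%R) by (apply lt_0_INR; lia).
  split.
  - pose proof (ln_le_sub_1 (INR n / INR (S n))) as H.
    rewrite ln_div in H by assumption.
    assert (E : (INR n / INR (S n) - 1 = - / INR (S n))%R) by (rewrite S_INR in *; field; lra).
    assert (P : (0 < INR n / INR (S n))%R) by now apply Rdiv_lt_0_compat.
    specialize (H P). lra.
  - pose proof (ln_le_sub_1 (INR (S n) / INR n)) as H.
    rewrite ln_div in H by assumption.
    assert (E : (INR (S n) / INR n - 1 = / INR n)%R) by (rewrite S_INR in *; field; lra).
    assert (P : (0 < INR (S n) / INR n)%R) by now apply Rdiv_lt_0_compat.
    specialize (H P). lra.
Qed.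

(** The reciprocals of the terms of Gauss's product.  They are entire in [z] and
    converge everywhere, to zero exactly at the poles of Gamma. *)
Definition rgamma_term (z : C) (n : nat) : C :=
  rising z (S n) / (INR (fact n) * Cexp (z * ln (INR n))).

Definition rgamma (z : C) : C := climit (rgamma_term z).

Lemma INR_S_neq_0 (n : nat) : RtoC (INR (S n)) <> 0.
Proof. intros H. apply RtoC_inj in H. revert H. apply not_0_INR. lia. Qed.

Lemma INR_fact_neq_0_C (n : nat) : RtoC (INR (fact n)) <> 0.
Proof. intros H. apply RtoC_inj in H. now apply INR_fact_neq_0 in H. Qed.

Lemma rgamma_term_step (z : C) (n : nat) :
  rgamma_term z (S n) =
  (1 + z / INR (S n)) * Cexp (- (z * (ln (INR (S n)) - ln (INR n))%R)) * rgamma_term z n.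
Proof.
  unfold rgamma_term. change (rising z (S (S n))) with (rising z (S n) * (z + INR (S n))).
  change (fact (S n)) with (S n * fact n)%nat. rewrite mult_INR, RtoC_mult.
  replace (Cexp (z * ln (INR (S n))))
    with (Cexp (z * (ln (INR (S n)) - ln (INR n))%R) * Cexp (z * ln (INR n))).
  - rewrite Cexp_opp.
    field. repeat split;
      first [apply Cexp_neq_0 | apply INR_fact_neq_0_C | apply INR_S_neq_0].
  - rewrite <- Cexp_plus. f_equal. rewrite RtoC_minus. ring.
Qed.

(** Successive terms of Gauss's product have the ratio
    (1 + z/(n+1)) exp(-z ln(1 + 1/n)), in which the terms of order 1/n cancel.
    For z in the disc of radius M the rest is at most [gauss_rate M] / n(n+1). *)
Definition gauss_rate (M : R) : R := (M + M * M + 28 * (1 + M) * (M * M))%R.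

Lemma gauss_factor_bound (z : C) (M : R) (n : nat) :
  (Cmod z <= M)%R -> (1 <= n)%nat -> (2 * M <= INR n)%R ->
  (Cmod ((1 + z / INR (S n)) * Cexp (- (z * (ln (INR (S n)) - ln (INR n))%R)) - 1)
   <= gauss_rate M / (INR n * INR (S n)))%R.
Proof.
  intros Hz Hn HM. set (h := (ln (INR (S n)) - ln (INR n))%R).
  destruct (ln_step n Hn) as [L1 L2]. fold h in L1, L2.
  assert (P1 : (1 <= INR n)%R) by (apply le_INR in Hn; simpl in Hn; lra).
  assert (P2 : (0 < INR (S n))%R) by (apply lt_0_INR; lia).
  pose proof (Cmod_ge_0 z) as Z0.
  assert (I1 : (0 < / INR n)%R) by (apply Rinv_0_lt_compat; lra).
  assert (I2 : (0 < / INR (S n))%R) by now apply Rinv_0_lt_compat.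
  set (u := - (z * h)).
  assert (Hu : (Cmod u = Cmod z * h)%R).
  { unfold u. rewrite Cmod_opp, Cmod_mult, Cmod_R, (Rabs_pos_eq h) by lra. reflexivity. }
  assert (Hu1 : (Cmod u <= M * / INR n)%R) by (rewrite Hu; apply Rmult_le_compat; lra).
  assert (Hu2 : (M * / INR n <= / 2)%R).
  { apply Rmult_le_reg_r with (INR n); [lra | ]. rewrite Rmult_assoc, Rinv_l; lra. }
  pose proof (Cexp_Taylor_1 u ltac:(lra)) as HT.
  set (t := Cexp u - 1 - u) in *.
  replace ((1 + z / INR (S n)) * Cexp u - 1)
    with (z * (/ INR (S n) - h)%R + - (z * z * (h * / INR (S n))%R)
          + (1 + z * (/ INR (S n))%R) * t).
  2:{ unfold t, u. rewrite RtoC_minus, RtoC_mult, RtoC_inv by lra. field.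
      apply INR_S_neq_0. }
  assert (Step : (/ INR n - / INR (S n) = / (INR n * INR (S n)))%R).
  { pose proof (inv_INR_step n Hn) as E. unfold Rdiv in E. lra. }
  set (d := (/ (INR n * INR (S n)))%R) in *.
  assert (Ed : (d = / INR n * / INR (S n))%R) by (unfold d; field; lra).
  assert (B1 : (Cmod (z * (/ INR (S n) - h)%R) <= M * d)%R).
  { rewrite Cmod_mult, Cmod_R, Rabs_left1 by lra. apply Rmult_le_compat; lra. }
  assert (B2 : (Cmod (- (z * z * (h * / INR (S n))%R)) <= M * M * d)%R).
  { rewrite Cmod_opp, !Cmod_mult, Cmod_R, Rabs_pos_eq by (apply Rmult_le_pos; lra).
    apply Rmult_le_compat; try apply Rmult_le_pos; try lra.
    - apply Rmult_le_compat; lra.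
    - rewrite Ed. apply Rmult_le_compat_r; lra. }
  assert (B3 : (Cmod ((1 + z * (/ INR (S n))%R) * t) <= 28 * (1 + M) * (M * M) * d)%R).
  { rewrite Cmod_mult.
    assert (C1 : (Cmod (1 + z * (/ INR (S n))%R) <= 1 + M)%R).
    { eapply Rle_trans; [apply Cmod_triangle | ].
      rewrite Cmod_1, Cmod_mult, Cmod_R, Rabs_pos_eq by lra.
      assert (/ INR (S n) <= 1)%R.
      { rewrite <- Rinv_1. apply Rinv_le_contravar; [lra | ]. rewrite S_INR. lra. }
      nra. }
    assert (C2 : (Cmod t <= 28 * (M * M) * d)%R).
    { eapply Rle_trans; [exact HT | ].
      assert (D1 : (/ INR n <= 2 * / INR (S n))%R).
      { apply Rmult_le_reg_r with (INR n * INR (S n))%R.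
        - apply Rmult_lt_0_compat; lra.
        - replace (/ INR n * (INR n * INR (S n)))%R with (INR (S n)) by (field; lra).
          replace (2 * / INR (S n) * (INR n * INR (S n)))%R with (2 * INR n)%R
            by (field; lra).
          rewrite S_INR. lra. }
      assert (D2 : (Cmod u * Cmod u <= (M * / INR n) * (M * / INR n))%R).
      { pose proof (Cmod_ge_0 u). apply Rmult_le_compat; lra. }
      assert (D3 : ((M * / INR n) * (M * / INR n) <= M * M * (2 * d))%R).
      { rewrite Ed.
        replace (M * / INR n * (M * / INR n))%R with (M * M * (/ INR n * / INR n))%R by ring.
        apply Rmult_le_compat_l; [nra | ]. nra. }
      lra. }
    eapply Rle_trans.
    - apply Rmult_le_compat; [apply Cmod_ge_0 | apply Cmod_ge_0 | exact C1 | exact C2].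
    - right. ring. }
  eapply Rle_trans; [apply Cmod_triangle | ].
  eapply Rle_trans; [apply Rplus_le_compat_r, Cmod_triangle | ].
  unfold gauss_rate, Rdiv. fold d. lra.
Qed.

Lemma gauss_rate_ge_0 (M : R) : (0 <= M)%R -> (0 <= gauss_rate M)%R.
Proof. intros HM. unfold gauss_rate. assert (0 <= M * M)%R by nra. nra. Qed.

(** The starting index [N0] serves all [z] in the disc of radius [M]: this
    uniformity gives the continuity of the limit. *)
Lemma rgamma_term_rate (M : R) : (0 <= M)%R ->
  exists N0 : nat, forall N, (N0 <= N)%nat -> forall z, (Cmod z <= M)%R ->
    tends eventually (rgamma_term z) (rgamma z) /\
    forall n, (N <= n)%nat ->
      (Cmod (rgamma_term z n - rgamma z)
       <= 2 * gauss_rate M * Cmod (rgamma_term z N) / INR n)%R.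
Proof.
  intros HM. pose proof (gauss_rate_ge_0 M HM) as HG.
  destruct (nfloor_ex (2 * gauss_rate M + 2 * M + 1)%R) as [N0 [_ HN0]]; [lra | ].
  exists (S N0). intros N HN z Hz. apply le_INR in HN. rewrite S_INR in HN.
  assert (HN1 : (1 <= N)%nat) by (apply INR_le; simpl; lra).
  destruct (slow_product (rgamma_term z) (gauss_rate M) N HG) as [l [Hl Hr]]; [lra | | ].
  - intros n Hn. rewrite rgamma_term_step. set (f := (1 + _) * _).
    replace (f * rgamma_term z n - rgamma_term z n) with ((f - 1) * rgamma_term z n) by ring.
    rewrite Cmod_mult. apply Rmult_le_compat_r; [apply Cmod_ge_0 | ].
    apply le_INR in Hn as Hn'. apply gauss_factor_bound; [exact Hz | lia | lra].
  - assert (E : rgamma z = l) by (apply tends_climit; exact Hl).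
    rewrite E. now split.
Qed.

Lemma rgamma_tends (z : C) : tends eventually (rgamma_term z) (rgamma z).
Proof.
  destruct (rgamma_term_rate (Cmod z) (Cmod_ge_0 z)) as [N HN].
  apply (HN N (Nat.le_refl N) z (Rle_refl _)).
Qed.

Lemma rising_pole (k n : nat) : (k < n)%nat -> rising (- INR k) n = 0.
Proof.
  intros H. induction H; simpl.
  - ring.
  - rewrite IHle. ring.
Qed.

Lemma rising_neq_0 (z : C) (n : nat) : ~ Gamma_pole z -> rising z n <> 0.
Proof.
  intros H. induction n; simpl; [apply C1_nz | ].
  apply Cmult_neq_0; [exact IHn | ]. intros E. apply H. exists n.
  replace z with (z + INR n - INR n) by ring. rewrite E. ring.
Qed.

Lemma rgamma_pole (z : C) : Gamma_pole z -> rgamma z = 0.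
Proof.
  intros [k ->]. apply (tends_unique (rgamma_term (- INR k))); [apply rgamma_tends | ].
  apply tends_ext_loc with (fun _ => RtoC 0); [ | apply tends_const].
  exists k. intros n Hn. unfold rgamma_term. rewrite rising_pole by lia.
  unfold Cdiv. ring.
Qed.

(** The error bound, taken at its own starting index N > 4 [gauss_rate], says
    that the limit differs from the nonzero N-th term by less than this term. *)
Lemma rgamma_neq_0 (z : C) : ~ Gamma_pole z -> rgamma z <> 0.
Proof.
  intros H E.
  pose proof (gauss_rate_ge_0 (Cmod z) (Cmod_ge_0 z)) as HG.
  destruct (rgamma_term_rate (Cmod z) (Cmod_ge_0 z)) as [N0 HN0].
  destruct (nfloor_ex (4 * gauss_rate (Cmod z) + 1)%R) as [N1 [_ HN1]]; [lra | ].
  set (N := (N0 + S N1)%nat).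
  assert (HN : (4 * gauss_rate (Cmod z) + 1 <= INR N)%R).
  { unfold N. rewrite plus_INR, S_INR. pose proof (pos_INR N0). lra. }
  destruct (HN0 N ltac:(unfold N; lia) z (Rle_refl _)) as [_ B].
  specialize (B N (Nat.le_refl N)). rewrite E in B.
  replace (rgamma_term z N - 0) with (rgamma_term z N) in B by ring.
  assert (P : (0 < Cmod (rgamma_term z N))%R).
  { apply Cmod_gt_0. unfold rgamma_term, Cdiv. apply Cmult_neq_0.
    - now apply rising_neq_0.
    - apply Cmod_gt_0. rewrite Cmod_inv.
      + apply Rinv_0_lt_compat, Cmod_gt_0, Cmult_neq_0;
          [apply INR_fact_neq_0_C | apply Cexp_neq_0].
      + apply Cmult_neq_0; [apply INR_fact_neq_0_C | apply Cexp_neq_0]. }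
  apply Rle_div_r in B; [ | lra]. nra.
Qed.

Lemma rgamma_neq_0_iff (z : C) : rgamma z <> 0 <-> ~ Gamma_pole z.
Proof.
  split; [ | apply rgamma_neq_0]. intros H P. now apply H, rgamma_pole.
Qed.

Lemma Gamma_inv_rgamma (z : C) : ~ Gamma_pole z -> Gamma z = / rgamma z.
Proof.
  intros H. change (Gamma z) with (climit (Gauss_term z)). apply tends_climit.
  apply tends_ext with (fun n => / rgamma_term z n).
  - intros n. unfold rgamma_term, Gauss_term. field.
    repeat split;
      first [now apply rising_neq_0 | apply Cexp_neq_0 | apply INR_fact_neq_0_C].
  - apply tends_inv; [now apply rgamma_neq_0 | apply rgamma_tends].
Qed.

Lemma Cexp_continuous (z : C) : tends (locally z) Cexp (Cexp z).
Proof.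
  intros eps Heps.
  pose proof (Cexp_neq_0 z) as H0. apply Cmod_gt_0 in H0.
  set (d := Rmin (/ 2) (eps / (8 * Cmod (Cexp z)))).
  apply locally_Cmod. exists d. split.
  { apply Rmin_glb_lt; [lra | ]. apply Rdiv_lt_0_compat; lra. }
  intros y Hy. pose proof (Rmin_l (/ 2) (eps / (8 * Cmod (Cexp z)))) as M1.
  pose proof (Rmin_r (/ 2) (eps / (8 * Cmod (Cexp z)))) as M2. fold d in M1, M2.
  set (u := y - z) in *.
  replace y with (z + u) by (unfold u; ring). rewrite Cexp_plus.
  replace (Cexp z * Cexp u - Cexp z) with (Cexp z * ((Cexp u - 1 - u) + u)) by ring.
  rewrite Cmod_mult.
  pose proof (Cexp_Taylor_1 u ltac:(lra)) as HT.
  pose proof (Cmod_triangle (Cexp u - 1 - u) u) as HC.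
  pose proof (Cmod_ge_0 u) as U0.
  assert (HU : (Cmod (Cexp u - 1 - u + u) <= 8 * Cmod u)%R) by nra.
  apply Rle_lt_trans with (Cmod (Cexp z) * (8 * Cmod u))%R.
  - apply Rmult_le_compat_l; lra.
  - assert (E : (Cmod (Cexp z) * (8 * (eps / (8 * Cmod (Cexp z)))) = eps)%R)
      by (field; lra).
    rewrite <- E. apply Rmult_lt_compat_l; lra.
Qed.

Lemma tends_comp {T : Type} (F : (T -> Prop) -> Prop) {FF : Filter F}
    (f : T -> C) (g : C -> C) (a b : C) :
  tends F f a -> tends (locally a) g b -> tends F (fun t => g (f t)) b.
Proof.
  intros Hf Hg eps Heps. destruct (proj1 (locally_Cmod _ _) (Hg eps Heps)) as [d [Hd H]].
  eapply filter_imp; [ | exact (Hf d Hd)]. intros t. apply H.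
Qed.

Lemma rising_continuous (n : nat) (z : C) :
  tends (locally z) (fun t => rising t n) (rising z n).
Proof.
  induction n; simpl; [apply tends_const | ].
  apply tends_mult; [exact IHn | ]. apply tends_plus; [apply tends_id | apply tends_const].
Qed.

Lemma rgamma_term_continuous (n : nat) (z : C) :
  tends (locally z) (fun t => rgamma_term t n) (rgamma_term z n).
Proof.
  apply tends_div.
  - apply Cmult_neq_0; [apply INR_fact_neq_0_C | apply Cexp_neq_0].
  - apply rising_continuous.
  - apply tends_mult; [apply tends_const | ].
    apply (tends_comp _ (fun t => t * ln (INR n)) Cexp (z * ln (INR n)));
      [ | apply Cexp_continuous].
    apply tends_mult; [apply tends_id | apply tends_const].
Qed.

(** The error bounds for Gauss's product are uniform on discs, so the limit
    inherits continuity from the terms. *)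
Lemma rgamma_continuous (z : C) : tends (locally z) rgamma (rgamma z).
Proof.
  intros eps Heps. set (M := (Cmod z + 1)%R).
  assert (HM : (0 <= M)%R) by (pose proof (Cmod_ge_0 z); unfold M; lra).
  destruct (rgamma_term_rate M HM) as [N HN].
  specialize (HN N (Nat.le_refl N)).
  pose proof (gauss_rate_ge_0 M HM) as HG.
  set (c := (2 * gauss_rate M * (Cmod (rgamma_term z N) + 1))%R).
  assert (Hc : (0 <= c)%R).
  { unfold c. pose proof (Cmod_ge_0 (rgamma_term z N)). apply Rmult_le_pos; lra. }
  destruct (nfloor_ex (3 * c / eps)%R) as [n0 [_ Hn0]].
  { apply Rdiv_le_0_compat; lra. }
  set (n := (N + S n0)%nat).
  assert (Hn : (c / INR n < eps / 3)%R).
  { assert (L : (3 * c / eps < INR n)%R).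
    { unfold n. rewrite plus_INR, S_INR. pose proof (pos_INR N). lra. }
    assert (Pn : (0 < INR n)%R) by (apply lt_0_INR; unfold n; lia).
    apply Rlt_div_l in L; [ | lra]. apply Rlt_div_l; lra. }
  assert (He3 : (0 < eps / 3)%R) by lra.
  eapply filter_imp;
    [ | exact (filter_and _ _ (rgamma_term_continuous n z _ He3)
               (filter_and _ _ (tends_bounded _ _ (rgamma_term_continuous N z))
                               (tends_id z _ Rlt_0_1)))].
  intros y [H1 [H2 H3]]. cbv beta in *.
  assert (Hunif : forall t, (Cmod t <= M)%R ->
            (Cmod (rgamma_term t N) <= Cmod (rgamma_term z N) + 1)%R ->
            (Cmod (rgamma_term t n - rgamma t) < eps / 3)%R).
  { intros t Ht Hb. eapply Rle_lt_trans; [ | exact Hn].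
    eapply Rle_trans; [apply (proj2 (HN t Ht)); unfold n; lia | ].
    apply Rmult_le_compat_r.
    - left. apply Rinv_0_lt_compat, lt_0_INR. unfold n. lia.
    - apply Rmult_le_compat_l; lra. }
  assert (Hy : (Cmod y <= M)%R).
  { pose proof (Cmod_triangle_rev y z). unfold M. lra. }
  pose proof (Hunif y Hy ltac:(lra)) as U1.
  pose proof (Hunif z ltac:(unfold M; lra) ltac:(lra)) as U2.
  pose proof (Cmod_sub_triangle (rgamma y) (rgamma_term y n) (rgamma z)) as T1.
  pose proof (Cmod_sub_triangle (rgamma_term y n) (rgamma_term z n) (rgamma z)) as T2.
  rewrite (Cmod_sub_comm (rgamma y) (rgamma_term y n)) in T1. lra.
Qed.

(** * Points of the sphere in homogeneous coordinates *)

(** The point p : q; the pair (0, 0) represents no point and is excluded in the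
    lemmas below. *)
Definition frac (p q : C) : sphere := if Ceq_dec q 0 then Infty else Fin (p / q).

Lemma frac_Fin (p q : C) : q <> 0 -> frac p q = Fin (p / q).
Proof. intros H. unfold frac. now destruct (Ceq_dec q 0). Qed.

Lemma frac_Infty (p : C) : frac p 0 = Infty.
Proof. unfold frac. now destruct (Ceq_dec 0 0). Qed.

Lemma frac_cross (p q p' q' : C) :
  ~ (p = 0 /\ q = 0) -> ~ (p' = 0 /\ q' = 0) -> p * q' = p' * q -> frac p q = frac p' q'.
Proof.
  intros H H' E. destruct (Ceq_dec q 0) as [->|Hq]; destruct (Ceq_dec q' 0) as [->|Hq'].
  - now rewrite !frac_Infty.
  - exfalso. destruct (Cmult_eq_0 p q') as [Z|Z]; [rewrite E; ring | | ]; tauto.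
  - exfalso. destruct (Cmult_eq_0 p' q) as [Z|Z]; [rewrite <- E; ring | | ]; tauto.
  - rewrite !frac_Fin by assumption. f_equal.
    apply (Cmult_cancel_l (q * q')); [now apply Cmult_neq_0 | ].
    replace (q * q' * (p / q)) with (p * q') by (field; assumption).
    rewrite E. field. assumption.
Qed.

Lemma sphere_add_frac (b p q : C) : sphere_add b (frac p q) = frac (b * q + p) q.
Proof.
  destruct (Ceq_dec q 0) as [->|Hq].
  - now rewrite !frac_Infty.
  - rewrite !frac_Fin by assumption. simpl. f_equal. field. assumption.
Qed.

Lemma sphere_div_frac (a p q : C) : a <> 0 -> ~ (p = 0 /\ q = 0) ->
  sphere_div a (frac p q) = frac (a * q) p.
Proof.
  intros Ha H. unfold sphere_div. destruct (Ceq_dec a 0) as [|_]; [contradiction | ].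
  destruct (Ceq_dec q 0) as [->|Hq].
  - rewrite frac_Infty, frac_Fin by tauto. f_equal.
    field. tauto.
  - rewrite frac_Fin by assumption. destruct (Ceq_dec p 0) as [->|Hp].
    + rewrite frac_Infty. destruct (Ceq_dec (0 / q) 0) as [|N]; [reflexivity | ].
      exfalso. apply N. field. assumption.
    + rewrite (frac_Fin (a * q) p) by assumption.
      destruct (Ceq_dec (p / q) 0) as [Z|_].
      * exfalso. apply Hp. replace p with (p / q * q) by (field; assumption).
        rewrite Z. ring.
      * f_equal. field. now split.
Qed.

Lemma frac_tends {T : Type} (F : (T -> Prop) -> Prop) {FF : Filter F}
    (f g : T -> C) (p q : C) :
  ~ (p = 0 /\ q = 0) -> tends F f p -> tends F g q ->
  filterlim (fun t => frac (f t) (g t)) F (sphere_locally (frac p q)).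
Proof.
  intros H Hf Hg P HP. unfold filtermap.
  destruct (Ceq_dec q 0) as [->|Hq].
  - rewrite frac_Infty in HP. destruct HP as [HI [M HM]].
    assert (Hp : p <> 0) by tauto. apply Cmod_gt_0 in Hp as Pp.
    set (e := (Cmod p / 2 / (Rabs M + 1))%R).
    pose proof (Rabs_pos M) as PM.
    assert (He : (0 < e)%R) by (apply Rdiv_lt_0_compat; lra).
    assert (Hh : (0 < Cmod p / 2)%R) by lra.
    eapply filter_imp; [ | exact (filter_and _ _ (Hf _ Hh) (Hg _ He))].
    intros t [H1 H2]. cbv beta in *. unfold frac.
    destruct (Ceq_dec (g t) 0) as [Z|Z]; [exact HI | ]. apply HM.
    apply Cmod_gt_0 in Z as Pg. rewrite Cmod_div by exact Z.
    replace (g t - 0) with (g t) in H2 by ring.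
    pose proof (Cmod_triangle_rev p (f t)) as T1. rewrite Cmod_sub_comm in T1.
    assert (E : (e * (Rabs M + 1) = Cmod p / 2)%R) by (unfold e; field; lra).
    apply Rlt_div_r; [exact Pg | ].
    pose proof (RRle_abs M). nra.
  - rewrite frac_Fin in HP by exact Hq. simpl in HP.
    apply locally_Cmod in HP. destruct HP as [eps [Heps HP]].
    eapply filter_imp;
      [ | exact (filter_and _ _ (tends_neq_0 g q Hq Hg) (tends_div f g p q Hq Hf Hg eps Heps))].
    intros t [H1 H2]. cbv beta in *. rewrite frac_Fin by exact H1. now apply HP.
Qed.

(** * Continued fractions with constant denominators *)

Section ContinuedFraction.

Variable kappa : nat -> C.

(** The solution of Y_n = x Y_(n-1) + kappa_n Y_(n-2) with Y_(-1) = u and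
    Y_0 = v; the index is shifted by one, so that [solution x u v (S n)] is
    Y_n. *)
Fixpoint solution (x u v : C) (n : nat) : C :=
  match n with
  | O => u
  | S m =>
      match m with
      | O => v
      | S l => x * solution x u v m + kappa m * solution x u v l
      end
  end.

Definition cf_num (x : C) : nat -> C := solution x 1 (x / 2).
Definition cf_den (x : C) : nat -> C := solution x 0 1.

Lemma solution_SS (x u v : C) (n : nat) :
  solution x u v (S (S n)) = x * solution x u v (S n) + kappa (S n) * solution x u v n.
Proof. reflexivity. Qed.

Lemma solution_unique (x : C) (y : nat -> C) :
  (forall n, y (S (S n)) = x * y (S n) + kappa (S n) * y n) ->
  forall n, y n = solution x (y O) (y 1%nat) n.
Proof.
  intros H n. enough (E : y n = solution x (y O) (y 1%nat) n /\
    y (S n) = solution x (y O) (y 1%nat) (S n)) by apply E.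
  induction n as [|n [IH1 IH2]]; [now split | ].
  split; [exact IH2 | ]. now rewrite H, solution_SS, IH1, <- IH2.
Qed.

Lemma solution_combination (x u v : C) (n : nat) :
  solution x u v n = u * cf_num x n + (v - u * (x / 2)) * cf_den x n.
Proof.
  symmetry. set (y := fun n => u * cf_num x n + (v - u * (x / 2)) * cf_den x n).
  change (y n = solution x u v n).
  replace u with (y O) at 1 by (unfold y, cf_num, cf_den; cbn [solution]; field).
  replace v with (y 1%nat) at 1 by (unfold y, cf_num, cf_den; cbn [solution]; field).
  apply solution_unique. intros m. unfold y, cf_num, cf_den. rewrite !solution_SS. ring.
Qed.

Lemma solution_scale (c x u v : C) (n : nat) :
  solution x (c * u) (c * v) n = c * solution x u v n.
Proof. rewrite !solution_combination. ring. Qed.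

(** The Casoratian of numerators and denominators is, up to sign, the product
    of the coefficients. *)
Lemma casoratian_neq_0 (x : C) (n : nat) :
  (forall i, (1 <= i <= n)%nat -> kappa i <> 0) ->
  cf_num x (S n) * cf_den x n - cf_num x n * cf_den x (S n) <> 0.
Proof.
  induction n as [|n IH]; intros H.
  - unfold cf_num, cf_den; cbn [solution]. replace (x / 2 * 0 - 1 * 1) with (- (1)) by ring. intros E.
    apply C1_nz. replace (RtoC 1) with (- - (1)) by ring. rewrite E. ring.
  - unfold cf_num, cf_den in *. rewrite !(solution_SS _ _ _ n).
    assert (IH' := IH ltac:(intros; apply H; lia)).
    assert (Hk : kappa (S n) <> 0) by (apply H; lia).
    intros Z. apply (Cmult_neq_0 _ _ Hk IH').
    match type of Z with ?w = _ => transitivity (- w); [ring | rewrite Z; ring] end.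
Qed.

Lemma cf_num_den_neq_0 (x : C) (n : nat) :
  (forall i, (1 <= i <= n)%nat -> kappa i <> 0) ->
  ~ (cf_num x (S n) = 0 /\ cf_den x (S n) = 0).
Proof.
  intros H [E1 E2]. apply (casoratian_neq_0 x n H). rewrite E1, E2. ring.
Qed.

(** Numerator and denominator of kappa_(j+1)/(x + ... + kappa_(j+n)/x),
    computed from the inside out. *)
Fixpoint tail (x : C) (j n : nat) : C * C :=
  match n with
  | O => (RtoC 0, RtoC 1)
  | S m => let (p, q) := tail x (S j) m in (kappa (S j) * q, x * q + p)
  end.

Lemma solution_tail (x u v : C) (n j : nat) :
  solution x u v (S (j + n)) =
  solution x u v (S j) * snd (tail x j n) + solution x u v j * fst (tail x j n).
Proof.
  revert j. induction n as [|n IH]; intros j.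
  - rewrite Nat.add_0_r. simpl tail. simpl fst. simpl snd. ring.
  - replace (j + S n)%nat with (S j + n)%nat by lia. rewrite IH, solution_SS.
    simpl tail. destruct (tail x (S j) n) as [p q]. simpl. ring.
Qed.

Definition cf_b (x : C) : nat -> C := fun n => match n with O => x / 2 | S _ => x end.

Lemma cf_K_tail (x : C) (n j : nat) :
  (forall i, (j < i <= j + n)%nat -> kappa i <> 0) ->
  ~ (fst (tail x j n) = 0 /\ snd (tail x j n) = 0) /\
  cf_K kappa (cf_b x) j n = frac (fst (tail x j n)) (snd (tail x j n)).
Proof.
  revert j. induction n as [|n IH]; intros j H; simpl.
  - split; [intros [_ E]; now apply C1_nz | ].
    rewrite frac_Fin by apply C1_nz. f_equal. field.
  - destruct (IH (S j)) as [Hn E]. { intros i Hi. apply H. lia. }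
    assert (Hk : kappa (S j) <> 0) by (apply H; lia).
    rewrite E. destruct (tail x (S j) n) as [p q]. simpl in *.
    assert (H0 : ~ (x * q + p = 0 /\ q = 0)).
    { intros [E1 E2]. apply Hn. split; [ | exact E2]. rewrite <- E1, E2. ring. }
    split.
    + intros [E1 E2]. apply H0. split; [exact E2 | ].
      destruct (Cmult_eq_0 _ _ E1); [contradiction | assumption].
    + rewrite sphere_add_frac. now apply sphere_div_frac.
Qed.

Lemma cf_approximant_frac (x : C) (n : nat) :
  (forall i, (1 <= i <= n)%nat -> kappa i <> 0) ->
  cf_approximant kappa (cf_b x) n = frac (cf_num x (S n)) (cf_den x (S n)).
Proof.
  intros H. unfold cf_approximant. destruct (cf_K_tail x n 0) as [_ ->].
  { intros i Hi. apply H. lia. }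
  rewrite sphere_add_frac. unfold cf_num, cf_den.
  change (S n) with (S (0 + n)). rewrite !solution_tail. cbn [solution cf_b].
  f_equal; ring.
Qed.

Lemma cf_K_truncated (b : nat -> C) (m : nat) : forall j n, (m <= n)%nat ->
  kappa (S (j + m)) = 0 -> cf_K kappa b j n = cf_K kappa b j m.
Proof.
  induction m as [|m IH]; intros j n Hn Hk.
  - destruct n as [|n]; [reflexivity | ]. simpl.
    rewrite Nat.add_0_r in Hk. unfold sphere_div. rewrite Hk.
    now destruct (Ceq_dec 0 0).
  - destruct n as [|n]; [lia | ]. simpl. rewrite (IH (S j) n); [reflexivity | lia | ].
    now replace (S j + m)%nat with (j + S m)%nat by lia.
Qed.

Lemma solution_continuous (u v : C -> C) (z : C) (n : nat) :
  tends (locally z) u (u z) -> tends (locally z) v (v z) ->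
  tends (locally z) (fun t => solution t (u t) (v t) n) (solution z (u z) (v z) n).
Proof.
  intros Hu Hv. enough (E : tends (locally z) (fun t => solution t (u t) (v t) n)
      (solution z (u z) (v z) n) /\
    tends (locally z) (fun t => solution t (u t) (v t) (S n))
      (solution z (u z) (v z) (S n))) by apply E.
  induction n as [|n [IH1 IH2]]; [now split | ].
  split; [exact IH2 | ]. rewrite solution_SS.
  apply (tends_ext (fun t => t * solution t (u t) (v t) (S n)
                             + kappa (S n) * solution t (u t) (v t) n)); [reflexivity | ].
  apply tends_plus; apply tends_mult; try assumption; [apply tends_id | apply tends_const].
Qed.

Lemma cf_num_continuous (n : nat) (z : C) :
  tends (locally z) (fun t => cf_num t n) (cf_num z n).
Proof.
  apply (solution_continuous (fun _ => RtoC 1) (fun t => t / 2)); [apply tends_const | ].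
  apply tends_mult; [apply tends_id | apply tends_const].
Qed.

Lemma cf_den_continuous (n : nat) (z : C) :
  tends (locally z) (fun t => cf_den t n) (cf_den z n).
Proof.
  apply (solution_continuous (fun _ => RtoC 0) (fun _ => RtoC 1)); apply tends_const.
Qed.

(** * Behaviour far to the right *)

Variable E : R.
Hypothesis kappa_near : forall n, (1 <= n)%nat ->
  (Cmod (4 * kappa n - INR n * (INR n - 1)) <= E)%R.

Lemma Re_Cinv_ge_0 (t : C) : (0 < Re t)%R -> (0 <= Re (/ t))%R.
Proof.
  intros H. destruct t as [a b]. simpl in *.
  apply Rdiv_le_0_compat; [lra | nra].
Qed.

(** A real kappa_n >= 0 maps the half plane Re t > 0 into itself by t |-> kappa_n/t,
    and the bounded error term of kappa_n costs at most E/(4 Re t); so the half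
    plane Re t >= Re x / 2 is stable under t |-> x + kappa_n/t once (Re x)^2 >= E. *)
Lemma tail_near_0 (x : C) (n : nat) :
  (0 < Re x)%R -> (E <= Re x * Re x)%R -> forall j,
  snd (tail x j n) <> 0 /\
  exists f, fst (tail x j n) = f * snd (tail x j n) /\
    (- (Re x / 2) <= Re f)%R /\ (Cmod f <= Cmod (kappa (S j)) / (Re x / 2))%R.
Proof.
  intros Hx HE. induction n as [|n IH]; intros j.
  - simpl. split; [apply C1_nz | ]. exists 0. split; [ring | ]. split; [simpl; lra | ].
    rewrite Cmod_0. apply Rdiv_le_0_compat; [apply Cmod_ge_0 | lra].
  - simpl. destruct (IH (S j)) as [Hq [f [Ef [Hf _]]]].
    destruct (tail x (S j) n) as [p q]. simpl in *. subst p.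
    set (t := x + f).
    assert (Ht : (Re x / 2 <= Re t)%R).
    { unfold t. change (Re (x + f)) with (Re x + Re f)%R. lra. }
    assert (Htm : (Re x / 2 <= Cmod t)%R).
    { pose proof (re_le_Cmod t). pose proof (RRle_abs (Re t)). lra. }
    assert (Ht0 : t <> 0) by (apply Cmod_gt_0; lra).
    replace (x * q + f * q) with (t * q) by (unfold t; ring).
    split; [now apply Cmult_neq_0 | ].
    exists (kappa (S j) / t). split; [field; exact Ht0 | split].
    + pose proof (kappa_near (S j) ltac:(lia)) as Hk.
      set (e := 4 * kappa (S j) - INR (S j) * (INR (S j) - 1)) in Hk.
      replace (kappa (S j) / t)
        with ((INR (S j) * (INR (S j) - 1) / 4)%R * (/ t) + e / (4 * t)).
      2:{ unfold e. rewrite RtoC_div, RtoC_mult, RtoC_minus by lra. field. exact Ht0. }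
      assert (He : (Cmod (e / (4 * t)) <= Re x / 2)%R).
      { assert (H4 : RtoC 4 <> 0) by (intros Z; apply RtoC_inj in Z; lra).
        rewrite Cmod_div, Cmod_mult, Cmod_R, (Rabs_pos_eq 4);
          [ | lra | now apply Cmult_neq_0].
        apply Rle_div_l; nra. }
      pose proof (re_le_Cmod (e / (4 * t))) as R1.
      pose proof (Re_Cinv_ge_0 t ltac:(lra)) as R2.
      pose proof (Rabs_le_between (Re (e / (4 * t))) (Re x / 2)) as [R3 _].
      specialize (R3 ltac:(lra)).
      set (w := e / (4 * t)) in *. set (s := / t) in *.
      change (Re ((INR (S j) * (INR (S j) - 1) / 4)%R * s + w))
        with ((INR (S j) * (INR (S j) - 1) / 4 * Re s - 0 * Im s) + Re w)%R.
      assert (0 <= INR (S j) * (INR (S j) - 1) / 4)%R.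
      { pose proof (pos_INR j). rewrite S_INR. nra. }
      nra.
    + rewrite Cmod_div by exact Ht0. apply Rmult_le_compat_l; [apply Cmod_ge_0 | ].
      apply Rinv_le_contravar; lra.
Qed.

(** Far to the right every tail keeps its denominator in a half plane, so the
    continued fraction is x/2 + O(1/x). *)
Lemma cf_near_half (x : C) (n : nat) :
  (0 < Re x)%R -> (E <= Re x * Re x)%R ->
  (Cmod (cf_num x (S n) - x / 2 * cf_den x (S n))
   <= Cmod (kappa 1) / (Re x / 2) * Cmod (cf_den x (S n)))%R.
Proof.
  intros Hx HE. destruct (tail_near_0 x n Hx HE 0) as [_ [f [Ef [_ Hf]]]].
  unfold cf_num, cf_den. change (S n) with (S (0 + n)). rewrite !solution_tail, Ef.
  cbn [solution]. set (q := snd (tail x 0 n)).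
  replace (x / 2 * q + 1 * (f * q) - x / 2 * (1 * q + 0 * (f * q))) with (f * q) by ring.
  replace (1 * q + 0 * (f * q)) with q by ring.
  rewrite Cmod_mult. apply Rmult_le_compat_r; [apply Cmod_ge_0 | exact Hf].
Qed.

End ContinuedFraction.

(** * Bauer-Muir transformation *)

(** Passing from Y to Y_n + r_n Y_(n-1) and back, with different modifying
    sequences [r] and [r'], carries solutions of the recurrence with denominator
    [x] to solutions of the same recurrence with denominator [x'], as soon as
    kappa_(n+1) - r_n (x + r_(n+1)) and its primed version do not depend on n
    and the two intermediate recurrences have the same denominators. *)
Lemma bauer_muir (kappa r r' Y : nat -> C) (x x' lam lam' : C) :
  (forall n, kappa (S n) - r n * (x + r (S n)) = lam) ->
  (forall n, kappa (S n) - r' n * (x' + r' (S n)) = lam') ->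
  (forall n, x + r (S (S n)) - r n = x' + r' (S (S n)) - r' n) ->
  (forall n, Y (S (S n)) = x * Y (S n) + kappa (S n) * Y n) ->
  let Z n := Y (S n) + r n * Y n in
  let W n := Z (S n) - (x' + r' (S n)) * Z n in
  forall n, W (S (S n)) = x' * W (S n) + kappa (S n) * W n.
Proof.
  intros H1 H2 H3 HY Z W n.
  assert (HZ : forall n, Z (S (S n)) =
            (x' + r' (S (S n)) - r' n) * Z (S n) + kappa (S n) * Z n).
  { intros m. rewrite <- H3. unfold Z. rewrite !HY.
    replace (kappa (S (S m))) with (lam + r (S m) * (x + r (S (S m))))
      by (rewrite <- (H1 (S m)); ring).
    replace (kappa (S m)) with (lam + r m * (x + r (S m))) by (rewrite <- (H1 m); ring).
    ring. }
  unfold W. rewrite !HZ.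
  replace (kappa (S (S n))) with (lam' + r' (S n) * (x' + r' (S (S n))))
    by (rewrite <- (H2 (S n)); ring).
  replace (kappa (S n)) with (lam' + r' n * (x' + r' (S n))) by (rewrite <- (H2 n); ring).
  ring.
Qed.

Section Coefficients.

(** With the third parameter c = 1 - a - b the coefficients, and with them the
    Gamma quotient, are symmetric in a, b, c. *)
Variables a b c : C.
Hypothesis sum_abc : a + b + c = 1.

Variable kappa : nat -> C.
Hypothesis kappa_odd : forall m : nat,
  kappa (2 * m + 1)%nat =
    (2 * INR m + 1 - a) * (2 * INR m + 1 - b) * (2 * INR m + 1 - c) / (4 * (2 * INR m + 1)).
Hypothesis kappa_even : forall m : nat,
  kappa (2 * m + 2)%nat =
    (2 * INR m + 1 + a) * (2 * INR m + 1 + b) * (2 * INR m + 1 + c) / (4 * (2 * INR m + 1)).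

Lemma INR_odd_neq_0 (m : nat) : 2 * INR m + 1 <> 0.
Proof.
  intros H. rewrite <- RtoC_mult, <- RtoC_plus in H. apply RtoC_inj in H.
  pose proof (pos_INR m). lra.
Qed.

Lemma RtoC_INR_even (m : nat) : RtoC (INR (2 * m)) = 2 * INR m.
Proof. now rewrite mult_INR, RtoC_mult. Qed.

Lemma RtoC_INR_S (m : nat) : RtoC (INR (S m)) = INR m + 1.
Proof. now rewrite S_INR, RtoC_plus. Qed.

Lemma RtoC_INR_odd (m : nat) : RtoC (INR (2 * m + 1)) = 2 * INR m + 1.
Proof. now rewrite Nat.add_1_r, RtoC_INR_S, RtoC_INR_even. Qed.

Lemma c_eq : c = 1 - a - b.
Proof. rewrite <- sum_abc. ring. Qed.

Definition coeff_error : R := (Cmod (a * b + a * c + b * c) + Cmod (a * b * c))%R.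

(** The coefficients are n(n-1)/4 up to a bounded error; the comparison with the
    solvable recurrence kappa_n = n(n-1)/4 is the source of all estimates. *)
Lemma coefficient_near (n : nat) : (1 <= n)%nat ->
  (Cmod (4 * kappa n - INR n * (INR n - 1)) <= coeff_error)%R.
Proof.
  intros Hn. assert (Hm : exists m, n = (2 * m + 1)%nat \/ n = (2 * m + 2)%nat).
  { destruct (Nat.Even_or_Odd n) as [[m ->]|[m ->]];
      [exists (m - 1)%nat | exists m]; lia. }
  destruct Hm as [m Hm]. pose proof (INR_odd_neq_0 m) as H0.
  assert (Hq : (Cmod (a * b * c / (2 * INR m + 1)) <= Cmod (a * b * c))%R).
  { rewrite Cmod_div by exact H0. apply Rle_div_l.
    - now apply Cmod_gt_0.
    - rewrite <- RtoC_mult, <- RtoC_plus, Cmod_R, Rabs_pos_eq;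
        pose proof (pos_INR m); pose proof (Cmod_ge_0 (a * b * c)); nra. }
  unfold coeff_error. destruct Hm as [-> | ->].
  - rewrite kappa_odd, RtoC_INR_odd.
    replace (4 * ((2 * INR m + 1 - a) * (2 * INR m + 1 - b) * (2 * INR m + 1 - c)
               / (4 * (2 * INR m + 1))) - (2 * INR m + 1) * (2 * INR m + 1 - 1))
      with ((a * b + a * c + b * c) + - (a * b * c / (2 * INR m + 1)))
      by (rewrite c_eq; field; exact H0).
    eapply Rle_trans; [apply Cmod_triangle | ]. rewrite Cmod_opp. lra.
  - rewrite kappa_even.
    replace (RtoC (INR (2 * m + 2))) with (2 * INR m + 1 + 1)
      by (rewrite <- RtoC_INR_odd, <- RtoC_INR_S; do 2 f_equal; lia).
    replace (4 * ((2 * INR m + 1 + a) * (2 * INR m + 1 + b) * (2 * INR m + 1 + c)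
               / (4 * (2 * INR m + 1))) - (2 * INR m + 1 + 1) * (2 * INR m + 1 + 1 - 1))
      with ((a * b + a * c + b * c) + (a * b * c / (2 * INR m + 1)))
      by (rewrite c_eq; field; exact H0).
    eapply Rle_trans; [apply Cmod_triangle | ]. lra.
Qed.

(** The sequence (n - y)/2 would make kappa_(n+1) - r_n (y + r_(n+1)) constant
    up to O(1/n); the correction at odd n removes the dependence on n
    altogether, see [modifier_defect]. *)
Definition modifier (y : C) (n : nat) : C :=
  (INR n - y + (if Nat.odd n then a * b * c / (1 + y) / INR n else 0)) / 2.

Definition defect (y : C) : C := (1 + y - a) * (1 + y - b) * (1 + y - c) / (4 * (1 + y)).

Lemma modifier_even (y : C) (m : nat) : modifier y (2 * m) = (2 * INR m - y) / 2.
Proof.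
  unfold modifier. rewrite Nat.odd_even, RtoC_INR_even. f_equal. ring.
Qed.

Lemma modifier_odd (y : C) (m : nat) :
  modifier y (2 * m + 1) =
  (2 * INR m + 1 - y + a * b * c / (1 + y) / (2 * INR m + 1)) / 2.
Proof. unfold modifier. now rewrite Nat.odd_odd, RtoC_INR_odd. Qed.

Lemma modifier_defect (y : C) (n : nat) : 1 + y <> 0 ->
  kappa (S n) - modifier y n * (y + modifier y (S n)) = defect y.
Proof.
  intros Hy. unfold defect.
  destruct (Nat.Even_or_Odd n) as [[m ->]|[m ->]].
  - replace (S (2 * m)) with (2 * m + 1)%nat by lia.
    rewrite modifier_even, modifier_odd, kappa_odd, c_eq. field.
    split; [exact Hy | apply INR_odd_neq_0].
  - replace (S (2 * m + 1)) with (2 * m + 2)%nat by lia. rewrite kappa_even.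
    replace (2 * m + 2)%nat with (2 * (S m))%nat by lia.
    rewrite modifier_even, modifier_odd, RtoC_INR_S, c_eq. field.
    split; [exact Hy | apply INR_odd_neq_0].
Qed.

(** The recurrences with denominators x and x + 2 have a common Bauer-Muir
    transform: modify the first by [modifier x], the second by the
    corresponding sequence for the reflected recurrence, that is [modifier] at
    -(x + 2) with the opposite sign. *)
Lemma modifier_shift (x : C) (n : nat) : 1 + x <> 0 ->
  x + modifier x (S (S n)) - modifier x n =
  (x + 2) + - modifier (- (x + 2)) (S (S n)) - - modifier (- (x + 2)) n.
Proof.
  intros Hx. assert (Hx' : 1 + - (x + 2) <> 0).
  { intros E. apply Hx. replace (1 + x) with (- (1 + - (x + 2))) by ring. rewrite E. ring. }
  destruct (Nat.Even_or_Odd n) as [[m ->]|[m ->]].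
  - replace (S (S (2 * m))) with (2 * (S m))%nat by lia.
    rewrite !modifier_even, RtoC_INR_S. field.
  - replace (S (S (2 * m + 1))) with (2 * (S m) + 1)%nat by lia.
    pose proof (INR_odd_neq_0 (S m)) as H1. pose proof (INR_odd_neq_0 m) as H2.
    rewrite !modifier_odd, RtoC_INR_S in *.
    replace (1 + - (x + 2)) with (- (1 + x)) by ring. field.
    repeat split; try assumption.
Qed.

Definition shifted (x : C) (Y : nat -> C) (n : nat) : C :=
  Y (S (S n)) + modifier x (S n) * Y (S n)
  - (x + 2 - modifier (- (x + 2)) (S n)) * (Y (S n) + modifier x n * Y n).

Lemma shifted_solution (x u v : C) : 1 + x <> 0 ->
  let Y := solution kappa x u v in
  forall n, shifted x Y n = solution kappa (x + 2) (shifted x Y O) (shifted x Y 1%nat) n.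
Proof.
  intros Hx Y n. assert (Hx' : 1 + - (x + 2) <> 0).
  { intros E. apply Hx. replace (1 + x) with (- (1 + - (x + 2))) by ring. rewrite E. ring. }
  assert (Hdefect : forall n, kappa (S n) - - modifier (- (x + 2)) n *
            (x + 2 + - modifier (- (x + 2)) (S n)) = defect (- (x + 2))).
  { intros m. rewrite <- (modifier_defect (- (x + 2)) m Hx'). ring. }
  apply solution_unique.
  exact (bauer_muir kappa (modifier x) (fun n => - modifier (- (x + 2)) n) Y x (x + 2)
    (defect x) (defect (- (x + 2)))
    (fun n => modifier_defect x n Hx) Hdefect
    (fun n => modifier_shift x n Hx) (solution_SS kappa x u v)).
Qed.

Lemma defect_reflected (x : C) : 1 + x <> 0 ->
  defect (- (x + 2)) = (1 + x + a) * (1 + x + b) * (1 + x + c) / (4 * (1 + x)).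
Proof.
  intros Hx. unfold defect.
  replace (1 + - (x + 2)) with (- (1 + x)) by ring. field. exact Hx.
Qed.

Lemma modifier_0 (y : C) : modifier y 0 = - (y / 2).
Proof. change O with (2 * 0)%nat at 1. rewrite modifier_even. simpl. field. Qed.

Lemma modifier_1 (x : C) : 1 + x <> 0 ->
  x + 2 - modifier (- (x + 2)) 1 = x + modifier x 1.
Proof.
  intros Hx. change 1%nat with (2 * 0 + 1)%nat. rewrite !modifier_odd.
  replace (1 + - (x + 2)) with (- (1 + x)) by ring. simpl. field. exact Hx.
Qed.

Lemma modifier_2 (x : C) : 1 + x <> 0 ->
  x + 2 - modifier (- (x + 2)) 2 = x + modifier x 2 - 1.
Proof.
  intros Hx. pose proof (modifier_shift x 0 Hx) as H. rewrite !modifier_0 in H.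
  replace (x + 2 - modifier (- (x + 2)) 2)
    with (x + 2 + - modifier (- (x + 2)) 2 - - - (- (x + 2) / 2) - (x + 2) / 2) by field.
  rewrite <- H. field.
Qed.

Lemma kappa_1_modifier (x : C) : 1 + x <> 0 ->
  kappa 1 = defect x - x / 2 * (x + modifier x 1).
Proof. intros Hx. rewrite <- (modifier_defect x 0 Hx), modifier_0. ring. Qed.

Lemma kappa_2_modifier (x : C) : 1 + x <> 0 ->
  kappa 2 = defect x + modifier x 1 * (x + modifier x 2).
Proof. intros Hx. rewrite <- (modifier_defect x 1 Hx). ring. Qed.

(** The transforms of the numerators and of the denominators at x are, up to
    different constant factors, the numerators and the denominators at x + 2.
    The ratio of these factors is the ratio by which the Gamma quotient changes. *)
Lemma shifted_num (x : C) (n : nat) : 1 + x <> 0 ->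
  shifted x (cf_num kappa x) n = defect x * cf_num kappa (x + 2) n.
Proof.
  intros Hx. unfold cf_num. rewrite (shifted_solution x 1 (x / 2) Hx).
  rewrite <- solution_scale. f_equal; unfold shifted; cbn [solution];
    rewrite ?(modifier_1 x Hx), ?(modifier_2 x Hx), ?(kappa_2_modifier x Hx),
      (kappa_1_modifier x Hx), ?modifier_0; field.
Qed.

Lemma shifted_den (x : C) (n : nat) : 1 + x <> 0 ->
  shifted x (cf_den kappa x) n = defect (- (x + 2)) * cf_den kappa (x + 2) n.
Proof.
  intros Hx. unfold cf_den. rewrite (shifted_solution x 0 1 Hx).
  rewrite <- solution_scale. f_equal; unfold shifted; cbn [solution];
    rewrite ?(modifier_1 x Hx), ?(modifier_2 x Hx), ?(kappa_2_modifier x Hx),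
      ?modifier_0; [ring | ].
  replace (defect (- (x + 2))) with (defect x + (x + modifier x 1)); [field | ].
  rewrite <- (modifier_1 x Hx) at 1. rewrite <- (modifier_defect (- (x + 2)) 0).
  - rewrite (kappa_1_modifier x Hx), modifier_0, <- (modifier_1 x Hx). field.
  - intros E. apply Hx. replace (1 + x) with (- (1 + - (x + 2))) by ring.
    rewrite E. ring.
Qed.

End Coefficients.

(** * Asymptotics in the right half plane *)

(** The contribution of the subdominant solution decays like n^(-theta), not
    summably, but it alternates in sign.  Hence averages of neighbouring terms,
    unlike the terms themselves, have summable steps, while the gaps tend to 0
    since the sum of 1/n diverges. *)
Section Oscillation.

Variables (s : nat -> C) (theta A : R) (N : nat).

Let gap n := s (S n) - s n.
Let mean n := (s (S n) + s n) / 2.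
Let K : R := (A / theta + 1)%R.
Let rate : R := ((1 + K) * A)%R.

Hypothesis theta_pos : (0 < theta)%R.
Hypothesis A_ge_0 : (0 <= A)%R.
Hypothesis N_large : (2 * rate + 1 <= INR N)%R.
Hypothesis gap_step : forall n, (N <= n)%nat ->
  (Cmod (gap (S n)) <= (1 - theta / INR n) * Cmod (gap n)
                       + A / (INR n * INR (S n)) * Cmod (s (S n)))%R.
Hypothesis mean_step : forall n, (N <= n)%nat ->
  (Cmod (mean (S n) - mean n) <= A / INR n * Cmod (gap n)
                                 + A / (INR n * INR (S n)) * Cmod (s (S n)))%R.

(** The weight K is so large that the damping of the gaps pays for the term
    A/n |gap| by which they move the mean; the energy then grows only by
    factors 1 + O(1/n^2). *)
Let energy n : R := (Cmod (mean n) + K * Cmod (gap n))%R.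

Let K_ge_1 : (1 <= K)%R.
Proof. unfold K. assert (0 <= A / theta)%R by (apply Rdiv_le_0_compat; lra). lra. Qed.

Let K_theta (n : nat) : (1 <= n)%nat -> (A / INR n <= K * (theta / INR n))%R.
Proof.
  intros Hn. apply lt_0_INR in Hn.
  replace (K * (theta / INR n))%R with (A / INR n + theta / INR n)%R
    by (unfold K; field; lra).
  assert (0 <= theta / INR n)%R by (apply Rdiv_le_0_compat; lra). lra.
Qed.

Let rate_ge_0 : (0 <= rate)%R.
Proof. unfold rate. pose proof K_ge_1. apply Rmult_le_pos; lra. Qed.

Let N_ge_1 : (1 <= N)%nat.
Proof. apply INR_le. simpl. pose proof rate_ge_0. lra. Qed.

Let term_le_energy (n : nat) : (Cmod (s (S n)) <= energy n)%R.
Proof.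
  replace (s (S n)) with (mean n + gap n / 2) by (unfold mean, gap; field).
  eapply Rle_trans; [apply Cmod_triangle | ]. unfold energy.
  rewrite Cmod_div by (intros Z; apply RtoC_inj in Z; lra).
  rewrite Cmod_R, Rabs_pos_eq by lra.
  pose proof (Cmod_ge_0 (gap n)). pose proof K_ge_1. nra.
Qed.

Let energy_ge_0 (n : nat) : (0 <= energy n)%R.
Proof.
  unfold energy. pose proof (Cmod_ge_0 (mean n)). pose proof (Cmod_ge_0 (gap n)).
  pose proof K_ge_1. nra.
Qed.

Let weight_pos (n : nat) : (N <= n)%nat -> (0 < 1 / (INR n * INR (S n)))%R.
Proof.
  intros Hn. pose proof N_ge_1. apply Rdiv_lt_0_compat; [lra | ].
  apply Rmult_lt_0_compat; apply lt_0_INR; lia.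
Qed.

Let energy_bound (n : nat) : (N <= n)%nat -> (energy n <= 2 * energy N)%R.
Proof.
  revert n. apply slow_growth with (c := rate); [exact rate_ge_0 | exact N_large | auto | ].
  intros n Hn. pose proof (gap_step n Hn) as H1. pose proof (mean_step n Hn) as H2.
  pose proof (Cmod_triangle_rev (mean (S n)) (mean n)) as H3.
  pose proof (term_le_energy n) as H4. pose proof (weight_pos n Hn) as Hw.
  pose proof N_ge_1. pose proof (K_theta n ltac:(lia)) as H5. pose proof K_ge_1 as H6.
  pose proof (Cmod_ge_0 (gap n)) as H7.
  set (w := (1 / (INR n * INR (S n)))%R) in *.
  replace (A / (INR n * INR (S n)))%R with (A * w)%R in H1, H2 by (unfold w, Rdiv; ring).
  replace (rate / (INR n * INR (S n)))%R with ((1 + K) * (A * w))%R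
    by (unfold rate, w, Rdiv; ring).
  assert (H8 : (A * w * Cmod (s (S n)) <= A * w * energy n)%R)
    by (apply Rmult_le_compat_l; [apply Rmult_le_pos | ]; lra).
  assert (H9 : (A / INR n * Cmod (gap n) <= K * (theta / INR n) * Cmod (gap n))%R)
    by (apply Rmult_le_compat_r; assumption).
  unfold energy at 1.
  assert (H10 : (K * Cmod (gap (S n)) <= K * ((1 - theta / INR n) * Cmod (gap n)
                  + A * w * energy n))%R) by (apply Rmult_le_compat_l; lra).
  unfold energy in *. lra.
Qed.

Let term_bound (n : nat) : (N <= n)%nat ->
  (A / (INR n * INR (S n)) * Cmod (s (S n))
   <= 2 * A * energy N * (1 / INR n - 1 / INR (S n)))%R.
Proof.
  intros Hn. pose proof N_ge_1. rewrite <- inv_INR_step by lia.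
  pose proof (weight_pos n Hn) as Hw. set (w := (1 / (INR n * INR (S n)))%R) in *.
  replace (A / (INR n * INR (S n)))%R with (A * w)%R by (unfold w, Rdiv; ring).
  replace (2 * A * energy N * w)%R with (A * w * (2 * energy N))%R by ring.
  apply Rmult_le_compat_l; [apply Rmult_le_pos; lra | ].
  eapply Rle_trans; [apply term_le_energy | now apply energy_bound].
Qed.

Let gap_tends_0 : is_lim_seq (fun n => Cmod (gap n)) 0.
Proof.
  set (B := (2 * A * energy N)%R).
  assert (HB : (0 <= B)%R).
  { unfold B. pose proof (energy_ge_0 N). apply Rmult_le_pos; lra. }
  set (f := fun n => (Cmod (gap n) + B * (1 / INR n))%R).
  assert (Hf : forall n, (N <= n)%nat ->
            (f (S n) <= f n - theta / INR n * Cmod (gap n))%R).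
  { intros n Hn. pose proof (gap_step n Hn) as H1. pose proof (term_bound n Hn) as H2.
    fold B in H2. unfold f. lra. }
  pose proof N_ge_1 as HN1.
  assert (Hpos : forall n, (N <= n)%nat -> (0 <= B * (1 / INR n))%R).
  { intros n Hn. apply Rmult_le_pos; [exact HB | ].
    apply Rdiv_le_0_compat; [lra | apply lt_0_INR; lia]. }
  assert (Hth : forall n, (N <= n)%nat -> (0 <= theta / INR n)%R).
  { intros n Hn. apply Rdiv_le_0_compat; [lra | apply lt_0_INR; lia]. }
  assert (Hlim : ex_finite_lim_seq (fun n => f (n + N)%nat)).
  { apply ex_finite_lim_seq_decr with 0%R; intros n.
    - simpl. pose proof (Hf (n + N)%nat ltac:(lia)) as H1.
      pose proof (Hth (n + N)%nat ltac:(lia)) as H2.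
      pose proof (Cmod_ge_0 (gap (n + N))). nra.
    - unfold f. pose proof (Cmod_ge_0 (gap (n + N))).
      pose proof (Hpos (n + N)%nat ltac:(lia)). lra. }
  destruct Hlim as [l Hl]. apply is_lim_seq_incr_n in Hl.
  assert (Hinv : is_lim_seq (fun n => B * (1 / INR n))%R 0).
  { apply is_lim_seq_ext with (fun n => B * / INR n)%R; [intros n; unfold Rdiv; ring | ].
    apply scaled_inverse_tends_0. }
  assert (Hg : is_lim_seq (fun n => Cmod (gap n)) l).
  { apply is_lim_seq_ext with (fun n => f n - B * (1 / INR n))%R; [intros n; unfold f; ring | ].
    replace (Finite l) with (Rbar_minus l 0) by (simpl; f_equal; ring).
    now apply is_lim_seq_minus'. }
  assert (Hl0 : (0 <= l)%R).
  { apply (is_lim_seq_le (fun _ => 0%R) (fun n => Cmod (gap n)) 0%R l);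
      [intros; apply Cmod_ge_0 | apply is_lim_seq_const | exact Hg]. }
  destruct (Rle_lt_or_eq_dec 0 l Hl0) as [Lpos | <-]; [exfalso | exact Hg].
  (* gaps bounded below would make f decrease at least like a multiple of ln *)
  assert (Lhalf : (0 < l / 2)%R) by lra.
  pose proof (proj2 (is_lim_seq_spec _ _) Hg (mkposreal _ Lhalf)) as [M HM].
  simpl in HM. set (M' := (M + N)%nat). set (d := (theta * (l / 2))%R).
  assert (Hd : (0 < d)%R) by (apply Rmult_lt_0_compat; lra).
  assert (Hdown : forall k, (f (k + M')%nat <= f M' - d * (ln (INR (k + M')) - ln (INR M')))%R).
  { induction k as [|k IH]; [rewrite Nat.add_0_l; lra | rewrite Nat.add_succ_l].
    assert (Hk : (N <= k + M')%nat) by (unfold M'; lia).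
    pose proof (Hf (k + M')%nat Hk) as H1.
    destruct (ln_step (k + M')%nat ltac:(lia)) as [_ H2].
    pose proof (HM (k + M')%nat ltac:(unfold M'; lia)) as H3.
    apply Rabs_lt_between in H3.
    assert (H4 : (theta / INR (k + M') * (l / 2)
                  <= theta / INR (k + M') * Cmod (gap (k + M')))%R).
    { apply Rmult_le_compat_l; [now apply Hth | lra]. }
    assert (H5 : (d * (ln (INR (S (k + M'))) - ln (INR (k + M'))) <= d * / INR (k + M'))%R)
      by (apply Rmult_le_compat_l; lra).
    unfold d in *. unfold Rdiv in *. lra. }
  set (T := (f M' / d + ln (INR M') + 1)%R).
  destruct (nfloor_ex (exp T)) as [k [_ Hk]]; [left; apply exp_pos | ].
  specialize (Hdown (S k)).
  assert (HT : (T < ln (INR (S k + M')))%R).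
  { rewrite <- (ln_exp T). apply ln_increasing; [apply exp_pos | ].
    rewrite plus_INR, S_INR. pose proof (pos_INR M'). lra. }
  assert (Hfp : (0 <= f (S k + M')%nat)%R).
  { unfold f at 1. pose proof (Cmod_ge_0 (gap (S k + M'))).
    pose proof (Hpos (S k + M')%nat ltac:(unfold M'; lia)). lra. }
  assert (HE : (d * T = f M' + d * ln (INR M') + d)%R) by (unfold T; field; lra).
  nra.
Qed.

Lemma oscillating_converges :
  exists l, tends eventually s l /\
    (Cmod ((s (S N) + s N) / 2 - l)
     <= K * Cmod (s (S N) - s N)
        + 2 * rate * (Cmod ((s (S N) + s N) / 2) + K * Cmod (s (S N) - s N)) / INR N)%R.
Proof.
  pose proof N_ge_1 as HN1. pose proof K_ge_1 as HK.
  destruct (telescoping_converges mean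
    (fun n => K * Cmod (gap n) + 2 * rate * energy N * (1 / INR n))%R N) as [l [Hl Hb]].
  - intros n Hn. pose proof (Cmod_ge_0 (gap n)). pose proof (energy_ge_0 N).
    pose proof rate_ge_0.
    apply Rplus_le_le_0_compat; [apply Rmult_le_pos; lra | ].
    apply Rmult_le_pos; [apply Rmult_le_pos; lra | ].
    apply Rdiv_le_0_compat; [lra | apply lt_0_INR; lia].
  - intros n Hn. pose proof (gap_step n Hn) as H1. pose proof (mean_step n Hn) as H2.
    pose proof (term_bound n Hn) as H3. pose proof (K_theta n ltac:(lia)) as H4.
    pose proof (Cmod_ge_0 (gap n)) as H5.
    set (t := (A / (INR n * INR (S n)) * Cmod (s (S n)))%R) in *.
    set (i := (1 / INR n - 1 / INR (S n))%R) in *.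
    assert (H6 : (A / INR n * Cmod (gap n) <= K * (theta / INR n) * Cmod (gap n))%R)
      by (apply Rmult_le_compat_r; assumption).
    assert (H7 : (K * Cmod (gap (S n)) <= K * ((1 - theta / INR n) * Cmod (gap n) + t))%R)
      by (apply Rmult_le_compat_l; lra).
    assert (H8 : ((1 + K) * t <= (1 + K) * (2 * A * energy N * i))%R)
      by (apply Rmult_le_compat_l; lra).
    replace (K * Cmod (gap n) + 2 * rate * energy N * (1 / INR n)
             - (K * Cmod (gap (S n)) + 2 * rate * energy N * (1 / INR (S n))))%R
      with (K * Cmod (gap n) - K * Cmod (gap (S n)) + (1 + K) * (2 * A * energy N * i))%R
      by (unfold rate, i; ring).
    lra.
  - exists l. split.
    + apply (tends_unshift s l 1).
      apply tends_ext with (fun n => mean n + gap n / 2).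
      { intros n. rewrite Nat.add_1_r. unfold mean, gap. field. }
      replace l with (l + 0 / 2) by (field).
      apply tends_plus; [exact Hl | ]. apply tends_mult; [ | apply tends_const].
      apply tends_squeeze with (fun n => Cmod (gap n)); [exact gap_tends_0 | ].
      apply filter_forall. intros n. replace (gap n - 0) with (gap n) by ring. lra.
    + specialize (Hb N (Nat.le_refl N)). unfold energy, mean, gap in Hb.
      eapply Rle_trans; [exact Hb | ]. right. unfold Rdiv. ring.
Qed.

End Oscillation.

Section RightHalfPlane.

Variables (kappa : nat -> C) (E : R) (x : C).
Hypothesis kappa_near : forall n, (1 <= n)%nat ->
  (Cmod (4 * kappa n - INR n * (INR n - 1)) <= E)%R.
Hypothesis Re_x : (0 < Re x)%R.

(** For kappa_n = n(n-1)/4 this sequence satisfies the recurrence up to a relative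
    error O(1/n^2), and so does its reflection in x -> -x with alternating signs;
    the quotient of the two behaves like n^(2x), so that for Re x > 0 this one
    dominates. *)
Fixpoint growth (y : C) (n : nat) : C :=
  match n with
  | O => 1
  | S m => growth y m * ((y + INR (S m)) / 2)
  end.

Lemma Cmod_add_INR (n : nat) : (Re x + INR n <= Cmod (x + INR n))%R.
Proof.
  pose proof (re_le_Cmod (x + INR n)) as H. pose proof (RRle_abs (Re (x + INR n))) as H1.
  change (Re (x + INR n)) with (Re x + INR n)%R in *. lra.
Qed.

Lemma add_INR_neq_0 (n : nat) : x + INR n <> 0.
Proof.
  apply Cmod_gt_0. pose proof (Cmod_add_INR n). pose proof (pos_INR n). lra.
Qed.

Lemma RtoC_2_neq_0 : RtoC 2 <> 0.
Proof. intros Z. apply RtoC_inj in Z. lra. Qed.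

Lemma Cmod_half (w : C) : Cmod (w / 2) = (Cmod w / 2)%R.
Proof.
  rewrite Cmod_div by apply RtoC_2_neq_0. now rewrite Cmod_R, Rabs_pos_eq by lra.
Qed.

Lemma growth_neq_0 (n : nat) : growth x n <> 0.
Proof.
  induction n as [|n IH]; [apply C1_nz | ]. cbn [growth].
  apply Cmult_neq_0; [exact IH | ]. intros Z.
  apply (add_INR_neq_0 (S n)).
  replace (x + INR (S n)) with (2 * ((x + INR (S n)) / 2)) by (field).
  rewrite Z. ring.
Qed.

Definition normalized (u v : C) (n : nat) : C :=
  solution kappa x u v (S n) / growth x n.

Let den (n : nat) : C := (x + INR (S (S n))) * (x + INR (S n)).

Lemma normalized_step (u v : C) (n : nat) :
  normalized u v (S (S n)) =
  2 * x / (x + INR (S (S n))) * normalized u v (S n)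
  + 4 * kappa (S (S n)) / den n * normalized u v n.
Proof.
  unfold normalized, den. rewrite (solution_SS _ _ _ _ (S n)). cbn [growth].
  field. repeat split; first [apply growth_neq_0 | apply add_INR_neq_0].
Qed.

Lemma den_lower (n : nat) :
  ((Re x + INR (S (S n))) * (Re x + INR (S n)) <= Cmod (den n))%R.
Proof.
  unfold den. rewrite Cmod_mult.
  pose proof (pos_INR (S (S n))). pose proof (pos_INR (S n)).
  apply Rmult_le_compat; try lra; apply Cmod_add_INR.
Qed.

Let A : R := (3 * Cmod x + Cmod x * Cmod x + E)%R.

Lemma E_ge_0 : (0 <= E)%R.
Proof. eapply Rle_trans; [apply Cmod_ge_0 | apply (kappa_near 1)]. lia. Qed.

Let A_ge_0 : (0 <= A)%R.
Proof. unfold A. pose proof E_ge_0. pose proof (Cmod_ge_0 x). nra. Qed.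

Let err (n : nat) : C := 4 * kappa n - INR n * (INR n - 1).

Lemma den_neq_0 (n : nat) : den n <> 0.
Proof. apply Cmult_neq_0; apply add_INR_neq_0. Qed.

(** The numerator is n^2 + 3n + O(1) and the denominator
    n^2 + (3 + 2x) n + O(1), which leaves 1 - 2 Re x / n to first order; half of
    the gain absorbs the rest. *)
Lemma gap_factor_small (n : nat) :
  (1 <= n)%nat -> (2 + 5 * Re x + Re x * Re x + E / Re x <= INR n)%R ->
  (Cmod (4 * kappa (S (S n)) / den n) <= 1 - Re x / INR n)%R.
Proof.
  intros Hn Hlarge. rewrite Cmod_div by apply den_neq_0.
  pose proof (den_lower n) as HD. apply le_INR in Hn as Hn1. simpl in Hn1.
  assert (Hnum : (Cmod (4 * kappa (S (S n))) <= (INR n + 2) * (INR n + 1) + E)%R).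
  { pose proof (kappa_near (S (S n)) ltac:(lia)) as HE. fold (err (S (S n))) in HE.
    replace (4 * kappa (S (S n)))
      with (((INR n + 2) * (INR n + 1))%R + err (S (S n))).
    - eapply Rle_trans; [apply Cmod_triangle | ].
      rewrite Cmod_R, Rabs_pos_eq by nra. lra.
    - unfold err. rewrite !S_INR, !RtoC_mult, !RtoC_plus. ring. }
  rewrite !S_INR in HD. set (m := INR n) in *. set (xi := Re x) in *.
  assert (HEx : (E <= (m - 2 - 5 * xi - xi * xi) * xi)%R).
  { apply Rle_div_l; [exact Re_x | ]. lra. }
  assert (Hpos : (0 < (xi + (m + 1 + 1)) * (xi + (m + 1)))%R) by nra.
  assert (Hxm : (0 <= 1 - xi / m)%R).
  { assert (xi / m <= 1)%R; [ | lra]. apply Rle_div_l; [lra | ].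
    assert (0 <= E / xi)%R by (pose proof E_ge_0; apply Rdiv_le_0_compat; lra). nra. }
  apply Rle_div_l; [lra | ].
  apply Rle_trans with ((1 - xi / m) * ((xi + (m + 1 + 1)) * (xi + (m + 1))))%R;
    [ | now apply Rmult_le_compat_l].
  eapply Rle_trans; [exact Hnum | ].
  apply Rmult_le_reg_r with m; [lra | ].
  replace ((1 - xi / m) * ((xi + (m + 1 + 1)) * (xi + (m + 1))) * m)%R
    with ((m - xi) * ((xi + (m + 1 + 1)) * (xi + (m + 1))))%R by (field; lra).
  assert (P1 : (E * m <= (m - 2 - 5 * xi - xi * xi) * xi * m)%R)
    by (apply Rmult_le_compat_r; lra).
  assert (0 <= xi * m)%R by nra. assert (0 <= xi * (m - 1))%R by nra.
  assert (0 <= xi * xi * (m - 1))%R by nra. assert (0 <= xi * xi * xi * (m - 1))%R.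
  { apply Rmult_le_pos; [ | lra]. nra. }
  assert (0 <= xi * xi)%R by nra. lra.
Qed.

Lemma weight_bound (w : C) (r : R) (n : nat) : (1 <= n)%nat ->
  (Cmod w <= r)%R -> (Cmod (w / den n) <= r / (INR n * INR (S n)))%R.
Proof.
  intros Hn Hw. pose proof (den_lower n) as HD. apply le_INR in Hn as Hn1. simpl in Hn1.
  rewrite Cmod_div by apply den_neq_0. rewrite !S_INR in *.
  pose proof (Cmod_ge_0 w).
  apply Rmult_le_compat; [lra | | exact Hw | ].
  - left. apply Rinv_0_lt_compat. nra.
  - apply Rinv_le_contravar; nra.
Qed.

Lemma normalized_gap (u v : C) (n : nat) :
  let s := normalized u v in
  s (S (S n)) - s (S n) =
  - (4 * kappa (S (S n)) / den n) * (s (S n) - s n)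
  + (x * x - x + err (S (S n))) / den n * s (S n).
Proof.
  intros s. unfold s. rewrite normalized_step.
  unfold err, den. rewrite !RtoC_INR_S. pose proof (add_INR_neq_0 (S n)) as H1.
  pose proof (add_INR_neq_0 (S (S n))) as H2. rewrite !RtoC_INR_S in H1.
  rewrite !RtoC_INR_S in H2.
  field. repeat split; assumption.
Qed.

Lemma normalized_mean (u v : C) (n : nat) :
  let s := normalized u v in
  (s (S (S n)) + s (S n)) / 2 - (s (S n) + s n) / 2 =
  (x * (2 * INR n + 3) + x * x - err (S (S n))) / den n * ((s (S n) - s n) / 2)
  + (x * x - x + err (S (S n))) / den n * (s (S n) / 2).
Proof.
  intros s. unfold s. rewrite normalized_step.
  unfold err, den. rewrite !RtoC_INR_S. pose proof (add_INR_neq_0 (S n)) as H1.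
  pose proof (add_INR_neq_0 (S (S n))) as H2. rewrite !RtoC_INR_S in H1.
  rewrite !RtoC_INR_S in H2.
  field. repeat split; assumption.
Qed.

Let forcing_bound (n : nat) : (1 <= n)%nat ->
  (Cmod ((x * x - x + err (S (S n))) / den n) <= A / (INR n * INR (S n)))%R.
Proof.
  intros Hn. apply weight_bound; [exact Hn | ].
  eapply Rle_trans; [apply Cmod_triangle | ].
  pose proof (kappa_near (S (S n)) ltac:(lia)) as HE. fold (err (S (S n))) in HE.
  pose proof (Cmod_triangle (x * x) (- x)) as H. rewrite Cmod_opp, Cmod_mult in H.
  change (x * x + - x) with (x * x - x) in H.
    pose proof (Cmod_ge_0 x). unfold A. lra.
Qed.

Let coupling_bound (n : nat) : (1 <= n)%nat ->
  (Cmod ((x * (2 * INR n + 3) + x * x - err (S (S n))) / den n) <= A / INR n)%R.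
Proof.
  intros Hn. pose proof (pos_INR n) as Hp. apply le_INR in Hn as Hn1. simpl in Hn1.
  eapply Rle_trans; [apply weight_bound with (r := (A * INR (S n))%R); [exact Hn | ] | ].
  - pose proof (kappa_near (S (S n)) ltac:(lia)) as HE. fold (err (S (S n))) in HE.
    pose proof (Cmod_triangle (x * (2 * INR n + 3) + x * x) (- err (S (S n)))) as H1.
    pose proof (Cmod_triangle (x * (2 * INR n + 3)) (x * x)) as H2.
    rewrite Cmod_opp in H1. rewrite !Cmod_mult in H2.
    rewrite <- RtoC_mult, <- RtoC_plus, Cmod_R, Rabs_pos_eq in H2 by lra.
    unfold Cminus. pose proof E_ge_0. pose proof (Cmod_ge_0 x).
    rewrite <- RtoC_mult, <- RtoC_plus in H1 |- *.
    unfold A. rewrite S_INR. set (m := INR n) in *.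
    assert (0 <= E * m)%R by nra. assert (0 <= Cmod x * Cmod x * m)%R by nra.
    assert (0 <= Cmod x * m)%R by nra. nra.
  - right. rewrite S_INR. field. lra.
Qed.

Let rate : R := ((1 + (A / Re x + 1)) * A)%R.

(** The nonvanishing in the second part rests on N0 being independent of the
    solution: a solution that starts at N with mean 1 and gap 0 moves by less
    than 1 from there on. *)
Lemma normalized_converges_from : exists N0 : nat, forall N u v, (N0 <= N)%nat ->
  exists l, tends eventually (normalized u v) l /\
    (normalized u v (S N) = 1 -> normalized u v N = 1 -> l <> 0).
Proof.
  destruct (nfloor_ex (2 * rate + 1 + (2 + 5 * Re x + Re x * Re x + E / Re x))%R)
    as [N0 [_ HN0]].
  { unfold rate. pose proof E_ge_0. assert (0 <= E / Re x)%R by (apply Rdiv_le_0_compat; lra).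
    assert (0 <= A / Re x)%R by (apply Rdiv_le_0_compat; lra).
    assert (0 <= (1 + (A / Re x + 1)) * A)%R by (apply Rmult_le_pos; lra). nra. }
  exists (S N0). intros N u v HN. apply le_INR in HN as HN'. rewrite S_INR in HN'.
  assert (Hr : (0 <= rate)%R).
  { unfold rate. assert (0 <= A / Re x)%R by (apply Rdiv_le_0_compat; lra).
    apply Rmult_le_pos; lra. }
  assert (Hl : (0 <= 2 + 5 * Re x + Re x * Re x + E / Re x)%R).
  { pose proof E_ge_0. assert (0 <= E / Re x)%R by (apply Rdiv_le_0_compat; lra). nra. }
  destruct (oscillating_converges (normalized u v) (Re x) A N Re_x A_ge_0)
    as [l [Htends Hb]].
  - fold rate. lra.
  - intros n Hn. apply le_INR in Hn as Hn'.
    rewrite normalized_gap. eapply Rle_trans; [apply Cmod_triangle | ].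
    rewrite !Cmod_mult, Cmod_opp.
    apply Rplus_le_compat; (apply Rmult_le_compat_r; [apply Cmod_ge_0 | ]).
    + apply gap_factor_small; [lia | lra].
    + apply forcing_bound. lia.
  - intros n Hn. rewrite normalized_mean. eapply Rle_trans; [apply Cmod_triangle | ].
    rewrite !Cmod_mult, !Cmod_half.
    pose proof (forcing_bound n ltac:(lia)) as H1.
    pose proof (coupling_bound n ltac:(lia)) as H2.
    pose proof (Cmod_ge_0 (normalized u v (S n))) as H3.
    pose proof (Cmod_ge_0 (normalized u v (S n) - normalized u v n)) as H4.
    apply Rplus_le_compat;
      (apply Rmult_le_compat; [apply Cmod_ge_0 | lra | assumption | lra]).
  - exists l. split; [exact Htends | ]. intros E1 E2 Hl0. rewrite E1, E2, Hl0 in Hb.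
    replace ((1 + 1) / 2 - 0) with (RtoC 1) in Hb by field.
    replace ((1 + 1) / 2) with (RtoC 1) in Hb by field.
    replace (1 - 1) with (RtoC 0) in Hb by ring.
    rewrite Cmod_1, Cmod_0 in Hb. fold rate in Hb.
    rewrite !Rmult_0_r, Rplus_0_l, Rplus_0_r, Rmult_1_r in Hb.
    apply Rle_div_r in Hb; lra.
Qed.

(** If no coefficient vanishes, the values of a solution at two consecutive
    indices can be prescribed, however late the indices, by nonvanishing of the
    Casoratian.  Hence some combination of numerators and denominators has a
    nonzero limit. *)
Lemma normalized_limits : exists U V : C,
  tends eventually (fun n => cf_num kappa x (S n) / growth x n) U /\
  tends eventually (fun n => cf_den kappa x (S n) / growth x n) V /\
  ((forall n, (1 <= n)%nat -> kappa n <> 0) -> ~ (U = 0 /\ V = 0)).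
Proof.
  destruct normalized_converges_from as [N HN].
  destruct (HN N 1 (x / 2) (Nat.le_refl N)) as [U [HU _]].
  destruct (HN N 0 1 (Nat.le_refl N)) as [V [HV _]].
  exists U, V. split; [exact HU | ]. split; [exact HV | ].
  intros Hk [-> ->].
  pose proof (casoratian_neq_0 kappa x (S N) ltac:(intros i Hi; apply Hk; lia)) as Hc.
  set (w := cf_num kappa x (S (S N)) * cf_den kappa x (S N)
            - cf_num kappa x (S N) * cf_den kappa x (S (S N))) in *.
  assert (Hw : w <> 0) by exact Hc.
  set (g1 := growth x (S N)). set (g0 := growth x N).
  set (u := (g1 * cf_den kappa x (S N) - g0 * cf_den kappa x (S (S N))) / w).
  set (t := (g0 * cf_num kappa x (S (S N)) - g1 * cf_num kappa x (S N)) / w).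
  set (v := t + u * (x / 2)).
  destruct (HN N u v (Nat.le_refl N)) as [l [Hl Hl0]].
  assert (Hg0 : g0 <> 0) by apply growth_neq_0.
  assert (Hg1 : g1 <> 0) by apply growth_neq_0.
  apply Hl0.
  - unfold normalized. rewrite solution_combination. fold g1.
    replace (v - u * (x / 2)) with t by (unfold v; ring).
    unfold u, t. replace (u * 0) with (RtoC 0) by ring.
    apply (Cmult_cancel_l (w * g1)); [now apply Cmult_neq_0 | ].
    transitivity (g1 * (cf_num kappa x (S (S N)) * cf_den kappa x (S N)
                  - cf_num kappa x (S N) * cf_den kappa x (S (S N)))).
    { field. now split. }
    fold w. ring.
  - unfold normalized. rewrite solution_combination. fold g0.
    replace (v - u * (x / 2)) with t by (unfold v; ring).
    unfold u, t.
    apply (Cmult_cancel_l (w * g0)); [now apply Cmult_neq_0 | ].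
    transitivity (g0 * (cf_num kappa x (S (S N)) * cf_den kappa x (S N)
                  - cf_num kappa x (S N) * cf_den kappa x (S (S N)))).
    { field. now split. }
    fold w. ring.
  - apply (tends_unique (normalized u v)); [exact Hl | ].
    apply tends_ext with (fun n => u * normalized 1 (x / 2) n
                                   + (v - u * (x / 2)) * normalized 0 1 n).
    + intros n. unfold normalized at 3. rewrite solution_combination.
      unfold normalized, cf_num, cf_den. field. apply growth_neq_0.
    + pose proof (tends_plus _ _ _ _
        (tends_mult _ _ _ _ (tends_const u) HU)
        (tends_mult _ _ _ _ (tends_const (v - u * (x / 2))) HV)) as T.
      assert (Z : u * 0 + (v - u * (x / 2)) * 0 = 0) by ring.
      rewrite Z in T. exact T.
Qed.

End RightHalfPlane.

(** * From x to x + 2 in the limit *)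

Lemma growth_shift (x : C) (n : nat) :
  growth x (S (S n)) = (1 + x) * (2 + x) / 4 * growth (x + 2) n.
Proof.
  induction n as [|n IH].
  - cbn [growth]. rewrite !RtoC_INR_S. simpl INR. field.
  - change (growth x (S (S (S n))))
      with (growth x (S (S n)) * ((x + INR (S (S (S n)))) / 2)).
    change (growth (x + 2) (S n)) with (growth (x + 2) n * ((x + 2 + INR (S n)) / 2)).
    rewrite IH, !RtoC_INR_S. field.
Qed.

Section Ratios.

Variable x : C.
Hypothesis Re_x : (0 < Re x)%R.

Lemma vanishing_ratio (w : nat -> C) (M : R) :
  (forall n, (1 <= n)%nat -> (Cmod (w n) <= M)%R) ->
  tends eventually (fun n => w n / (x + INR n)) 0.
Proof.
  intros Hw. apply tends_squeeze with (fun n => (M * / INR n)%R).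
  - apply scaled_inverse_tends_0.
  - exists 1%nat. intros n Hn. apply lt_0_INR in Hn as Hp.
    pose proof (Cmod_add_INR x n) as H.
    replace (w n / (x + INR n) - 0) with (w n / (x + INR n)) by ring.
    rewrite Cmod_div by now apply add_INR_neq_0.
    pose proof (Cmod_ge_0 (w n)).
    apply Rmult_le_compat; [lra | | now apply Hw | ].
    + left. apply Rinv_0_lt_compat. lra.
    + apply Rinv_le_contravar; lra.
Qed.

Lemma modifier_ratio (a b c y : C) :
  tends eventually (fun n => 2 * modifier a b c y n / (x + INR n)) 1.
Proof.
  set (w := fun n => - y - x + (if Nat.odd n then a * b * c / (1 + y) / INR n else 0)).
  assert (E : RtoC 1 = 1 + 0) by ring. rewrite E.
  apply tends_ext with (fun n => 1 + w n / (x + INR n)).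
  - intros n. unfold w, modifier. set (o := if Nat.odd n then _ else _).
    field. now apply add_INR_neq_0.
  - apply tends_plus; [apply tends_const | ].
    apply vanishing_ratio with (Cmod (- y - x) + Cmod (a * b * c / (1 + y)))%R.
    intros n Hn. unfold w. eapply Rle_trans; [apply Cmod_triangle | ].
    apply Rplus_le_compat_l. pose proof (Cmod_ge_0 (a * b * c / (1 + y))) as H0.
    destruct (Nat.odd n); [ | rewrite Cmod_0; exact H0].
    apply le_INR in Hn. simpl in Hn.
    rewrite Cmod_div by (intros Z; apply RtoC_inj in Z; lra).
    rewrite Cmod_INR. apply Rle_div_l; nra.
Qed.

(** In the limit the Bauer-Muir transformation becomes multiplication by
    (1 + x)(2 + x), because the modifiers are asymptotic to n/2, the ratio of
    successive values of [growth]. *)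
Lemma shifted_limit (a b c : C) (Y : nat -> C) (U : C) :
  tends eventually (fun n => Y (S n) / growth x n) U ->
  tends eventually (fun n => shifted a b c x Y (S n) / growth (x + 2) n)
    ((1 + x) * (2 + x) * U).
Proof.
  intros H.
  assert (H1x : 1 + x <> 0).
  { pose proof (add_INR_neq_0 x Re_x 1) as N. simpl in N. now rewrite Cplus_comm. }
  assert (H2x : 2 + x <> 0).
  { pose proof (add_INR_neq_0 x Re_x 2) as N. rewrite !RtoC_INR_S in N.
    intros Z. apply N. transitivity (2 + x); [simpl INR; ring | exact Z]. }
  set (s := fun n => Y (S n) / growth x n) in H.
  pose proof (tends_shift _ _ 1 H) as Hs1. pose proof (tends_shift _ _ 2 H) as Hs2.
  pose proof (tends_shift _ _ 1 (modifier_ratio a b c x)) as M1.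
  pose proof (tends_shift _ _ 2 (modifier_ratio a b c x)) as M2.
  pose proof (tends_shift _ _ 2 (modifier_ratio a b c (- (x + 2)))) as M3.
  pose proof (tends_shift _ _ 2 (vanishing_ratio (fun _ => 2 * (x + 2)) (Cmod (2 * (x + 2)))
                (fun n _ => Rle_refl _))) as M4.
  pose proof (tends_mult _ _ _ _ (tends_const ((1 + x) * (2 + x) / 4))
    (tends_minus _ _ _ _ (tends_plus _ _ _ _ Hs2 (tends_mult _ _ _ _ M2 Hs1))
      (tends_mult _ _ _ _ (tends_minus _ _ _ _ M4 M3)
        (tends_plus _ _ _ _ Hs1 (tends_mult _ _ _ _ M1 H))))) as T.
  cbv beta in T.
  replace ((1 + x) * (2 + x) / 4 * (U + 1 * U - (0 - 1) * (U + 1 * U)))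
    with ((1 + x) * (2 + x) * U) in T by field.
  refine (tends_ext _ _ _ _ T). intros n. unfold s, shifted.
  rewrite !Nat.add_1_r. replace (n + 2)%nat with (S (S n)) by lia.
  assert (Hg : growth (x + 2) n = growth x (S (S n)) / ((1 + x) * (2 + x) / 4)).
  { rewrite growth_shift. field. now split. }
  rewrite Hg. cbn [growth].
  pose proof (growth_neq_0 x Re_x n). pose proof (add_INR_neq_0 x Re_x (S n)).
  pose proof (add_INR_neq_0 x Re_x (S (S n))).
  field. repeat split; assumption.
Qed.

End Ratios.

(** * Solving the functional equation *)

(** A quotient U/V that is multiplied by a known rational function when x grows
    by 2, and is x/2 + O(1) far to the right, is a quotient of Gamma factors:
    iterate and compare with Gauss's product.  Homogeneous coordinates allow
    U and V to have zeros, at x or at any x + 2n. *)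
Section FunctionalEquation.

Variables a b c : C.
Hypothesis sum_abc : a + b + c = 1.
Variables (U V : C -> C) (D : C -> Prop).
Hypothesis D_shift : forall x, D x -> D (x + 2).
Hypothesis UV_neq_0 : forall x, D x -> ~ (U x = 0 /\ V x = 0).
Hypothesis UV_shift : forall x, D x ->
  U (x + 2) * V x * ((1 + x - a) / 2 * ((1 + x - b) / 2) * ((1 + x - c) / 2)) =
  U x * V (x + 2) * ((1 + x + a) / 2 * ((1 + x + b) / 2) * ((1 + x + c) / 2)).
Variables X0 r : R.
Hypothesis UV_far : forall x, D x -> (X0 <= Re x)%R ->
  (Cmod (U x - x / 2 * V x) <= r * Cmod (V x))%R.

Lemma D_shift_n (x : C) (n : nat) : D x -> D (x + 2 * INR n).
Proof.
  intros H. induction n as [|n IH].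
  - simpl. now replace (x + 2 * 0) with x by ring.
  - rewrite RtoC_INR_S. replace (x + 2 * (INR n + 1)) with (x + 2 * INR n + 2) by ring.
    now apply D_shift.
Qed.

Lemma UV_shift_n (x : C) (n : nat) : D x ->
  U x * V (x + 2 * INR n) *
    (rising ((1 + x + a) / 2) n * rising ((1 + x + b) / 2) n * rising ((1 + x + c) / 2) n) =
  V x * U (x + 2 * INR n) *
    (rising ((1 + x - a) / 2) n * rising ((1 + x - b) / 2) n * rising ((1 + x - c) / 2) n).
Proof.
  intros HD. induction n as [|n IH].
  - simpl. replace (x + 2 * 0) with x by ring. ring.
  - pose proof (D_shift_n x n HD) as Hn. pose proof (UV_shift _ Hn) as H1.
    rewrite RtoC_INR_S. replace (x + 2 * (INR n + 1)) with (x + 2 * INR n + 2) by ring.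
    cbn [rising].
    set (y := x + 2 * INR n) in *.
    replace ((1 + x + a) / 2 + INR n) with ((1 + y + a) / 2) by (unfold y; field).
    replace ((1 + x + b) / 2 + INR n) with ((1 + y + b) / 2) by (unfold y; field).
    replace ((1 + x + c) / 2 + INR n) with ((1 + y + c) / 2) by (unfold y; field).
    replace ((1 + x - a) / 2 + INR n) with ((1 + y - a) / 2) by (unfold y; field).
    replace ((1 + x - b) / 2 + INR n) with ((1 + y - b) / 2) by (unfold y; field).
    replace ((1 + x - c) / 2 + INR n) with ((1 + y - c) / 2) by (unfold y; field).
    set (p1 := rising ((1 + x + a) / 2) n) in *. set (p2 := rising ((1 + x + b) / 2) n) in *.
    set (p3 := rising ((1 + x + c) / 2) n) in *. set (q1 := rising ((1 + x - a) / 2) n) in *.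
    set (q2 := rising ((1 + x - b) / 2) n) in *. set (q3 := rising ((1 + x - c) / 2) n) in *.
    set (t1 := (1 + y + a) / 2) in *. set (t2 := (1 + y + b) / 2) in *.
    set (t3 := (1 + y + c) / 2) in *. set (s1 := (1 + y - a) / 2) in *.
    set (s2 := (1 + y - b) / 2) in *. set (s3 := (1 + y - c) / 2) in *.
    (* the two sides agree after multiplication by U y and by V y, of which one
       is nonzero *)
    destruct (Ceq_dec (V y) 0) as [HV|HV].
    + assert (HU : U y <> 0) by (intros Z; now apply (UV_neq_0 y Hn)).
      apply (Cmult_cancel_l (U y)); [exact HU | ].
      transitivity (U x * (p1 * p2 * p3) * (U y * V (y + 2) * (t1 * t2 * t3))); [ring | ].
      rewrite <- H1.
      transitivity ((U x * V y * (p1 * p2 * p3)) * (U (y + 2) * (s1 * s2 * s3))); [ring | ].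
      rewrite IH. ring.
    + apply (Cmult_cancel_l (V y)); [exact HV | ].
      transitivity ((U x * V y * (p1 * p2 * p3)) * (V (y + 2) * (t1 * t2 * t3))); [ring | ].
      rewrite IH.
      transitivity (V x * (q1 * q2 * q3) * (U y * V (y + 2) * (t1 * t2 * t3))); [ring | ].
      rewrite <- H1. ring.
Qed.

Lemma V_far_neq_0 (x : C) : D x -> (X0 <= Re x)%R -> V x <> 0.
Proof.
  intros HD Hx Z. pose proof (UV_far x HD Hx) as H. rewrite Z in H.
  replace (U x - x / 2 * 0) with (U x) in H by ring.
  rewrite Cmod_0, Rmult_0_r in H. apply (UV_neq_0 x HD). split; [ | exact Z].
  apply Cmod_eq_0. pose proof (Cmod_ge_0 (U x)). lra.
Qed.

Lemma far_right (x : C) : exists N, forall n, (N <= n)%nat ->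
  (X0 <= Re (x + 2 * INR (S n)))%R.
Proof.
  destruct (nfloor_ex (Rabs (X0 - Re x))) as [N [_ HN]]; [apply Rabs_pos | ].
  exists N. intros n Hn. apply le_INR in Hn.
  replace (Re (x + 2 * INR (S n))) with (Re x + 2 * INR (S n))%R
    by (generalize (INR (S n)); intros m; unfold Re; simpl; ring).
  rewrite S_INR. pose proof (RRle_abs (X0 - Re x)). pose proof (pos_INR N). lra.
Qed.

Lemma quotient_asymptotics (x : C) : D x ->
  tends eventually
    (fun n => U (x + 2 * INR (S n)) / V (x + 2 * INR (S n)) / INR n) 1.
Proof.
  intros HD. destruct (far_right x) as [N HN].
  set (M := (Rabs r + Cmod (x / 2 + 1))%R).
  apply tends_squeeze with (fun n => (M * / INR n)%R).
  - apply scaled_inverse_tends_0.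
  - exists (S N). intros n Hn.
    pose proof (HN n ltac:(lia)) as Hy. pose proof (D_shift_n x (S n) HD) as Dy.
    set (y := x + 2 * INR (S n)) in *.
    pose proof (V_far_neq_0 y Dy Hy) as HV. pose proof (UV_far y Dy Hy) as HF.
    assert (Hn0 : (0 < INR n)%R) by (apply lt_0_INR; lia).
    assert (Hnc : RtoC (INR n) <> 0) by (intros Z; apply RtoC_inj in Z; lra).
    replace (U y / V y / INR n - 1) with (((U y - y / 2 * V y) / V y + (x / 2 + 1)) / INR n).
    2:{ unfold y at 2. rewrite RtoC_INR_S. field. now split. }
    rewrite Cmod_div by exact Hnc. rewrite Cmod_INR.
    apply Rmult_le_compat_r; [left; now apply Rinv_0_lt_compat | ].
    eapply Rle_trans; [apply Cmod_triangle | ]. apply Rplus_le_compat_r.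
    rewrite Cmod_div by exact HV. apply Cmod_gt_0 in HV.
    apply Rle_trans with r; [now apply Rle_div_l | apply RRle_abs].
Qed.

Lemma Gamma_factors (x : C) : D x ->
  U x * (rgamma ((1 + x + a) / 2) * rgamma ((1 + x + b) / 2) * rgamma ((1 + x + c) / 2)) =
  V x * (rgamma ((1 + x - a) / 2) * rgamma ((1 + x - b) / 2) * rgamma ((1 + x - c) / 2)).
Proof.
  intros HD.
  pose proof (quotient_asymptotics x HD) as HQ.
  pose proof (tends_mult _ _ _ _ (tends_const (U x)) (tends_mult _ _ _ _ (tends_mult _ _ _ _
    (rgamma_tends ((1 + x + a) / 2)) (rgamma_tends ((1 + x + b) / 2)))
    (rgamma_tends ((1 + x + c) / 2)))) as T1.
  pose proof (tends_mult _ _ _ _ (tends_mult _ _ _ _ (tends_const (V x)) HQ)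
    (tends_mult _ _ _ _ (tends_mult _ _ _ _
    (rgamma_tends ((1 + x - a) / 2)) (rgamma_tends ((1 + x - b) / 2)))
    (rgamma_tends ((1 + x - c) / 2)))) as T2.
  replace (V x * 1) with (V x) in T2 by ring.
  refine (tends_unique _ _ _ T1 (tends_ext_loc _ _ _ _ T2)).
  destruct (far_right x) as [N HN]. exists (S N). intros n Hn. cbv beta.
  pose proof (UV_shift_n x (S n) HD) as HS.
  pose proof (V_far_neq_0 _ (D_shift_n x (S n) HD) (HN n ltac:(lia))) as HV.
  set (y := x + 2 * INR (S n)) in *. unfold rgamma_term.
  assert (Hn0 : (0 < INR n)%R) by (apply lt_0_INR; lia).
  assert (Hnc : RtoC (INR n) <> 0) by (intros Z; apply RtoC_inj in Z; lra).
  set (L := RtoC (ln (INR n))).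
  replace ((1 + x + a) / 2 * L) with ((1 + x - a) / 2 * L + a * L) by field.
  replace ((1 + x + b) / 2 * L) with ((1 + x - b) / 2 * L + b * L) by field.
  replace ((1 + x + c) / 2 * L) with ((1 + x - c) / 2 * L + c * L) by field.
  rewrite !Cexp_plus.
  (* the powers of n in the two products of Gauss terms differ by n^(a+b+c) = n,
     which the linear growth of U/V compensates *)
  assert (HL : Cexp (a * L) * Cexp (b * L) * Cexp (c * L) = INR n).
  { rewrite <- !Cexp_plus. replace (a * L + b * L + c * L) with ((a + b + c) * L) by ring.
    rewrite sum_abc. replace (1 * L) with L by ring. unfold L.
    now rewrite Cexp_RtoC, exp_ln. }
  set (ea := Cexp (a * L)) in *. set (eb := Cexp (b * L)) in *. set (ec := Cexp (c * L)) in *.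
  assert (Ha : ea <> 0) by apply Cexp_neq_0. assert (Hb : eb <> 0) by apply Cexp_neq_0.
  assert (Hc : ec <> 0) by apply Cexp_neq_0. rewrite <- HL.
  set (g1 := Cexp ((1 + x - a) / 2 * L)). set (g2 := Cexp ((1 + x - b) / 2 * L)).
  set (g3 := Cexp ((1 + x - c) / 2 * L)).
  assert (G1 : g1 <> 0) by apply Cexp_neq_0. assert (G2 : g2 <> 0) by apply Cexp_neq_0.
  assert (G3 : g3 <> 0) by apply Cexp_neq_0.
  set (f := RtoC (INR (fact n))). assert (Hf : f <> 0) by apply INR_fact_neq_0_C.
  set (p1 := rising ((1 + x + a) / 2) (S n)) in *.
  set (p2 := rising ((1 + x + b) / 2) (S n)) in *.
  set (p3 := rising ((1 + x + c) / 2) (S n)) in *.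
  set (q1 := rising ((1 + x - a) / 2) (S n)) in *.
  set (q2 := rising ((1 + x - b) / 2) (S n)) in *.
  set (q3 := rising ((1 + x - c) / 2) (S n)) in *.
  clearbody y ea eb ec g1 g2 g3 f p1 p2 p3 q1 q2 q3.
  transitivity (V x * U y * (q1 * q2 * q3)
                / (V y * (f * f * f * (g1 * g2 * g3)) * (ea * eb * ec))).
  { field. repeat split; assumption. }
  rewrite <- HS. field. repeat split; assumption.
Qed.

End FunctionalEquation.

(** * The Gamma quotient *)

Lemma Cmult_3_neq_0 (u v w : C) : u * v * w <> 0 <-> (u <> 0 /\ v <> 0 /\ w <> 0).
Proof.
  split.
  - intros H. repeat split; intros Z; apply H; rewrite Z; ring.
  - intros [Hu [Hv Hw]]. now repeat apply Cmult_neq_0.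
Qed.

(** The poles of Gamma are isolated: where 1/Gamma does not vanish by
    continuity, and around a pole because two poles are at distance 1 or more. *)
Lemma rgamma_neq_0_nearby (x d : C) :
  locally' x (fun t => rgamma ((t + d) / 2) <> 0).
Proof.
  destruct (Ceq_dec (rgamma ((x + d) / 2)) 0) as [Z|NZ].
  - assert (Hp : Gamma_pole ((x + d) / 2)).
    { apply NNPP. intros H. now apply (rgamma_neq_0 _ H). }
    destruct Hp as [k Hk].
    apply locally'_Cmod. exists 2%R. split; [lra | ]. intros t Ht Hne.
    apply rgamma_neq_0. intros [l Hl]. apply Hne.
    assert (Hd : t - x = 2 * (INR k - INR l)).
    { replace (t - x) with (2 * ((t + d) / 2 - (x + d) / 2)) by field.
      rewrite Hk, Hl. ring. }
    rewrite Hd, Cmod_mult, <- RtoC_minus, !Cmod_R, (Rabs_pos_eq 2) in Ht by lra.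
    assert (Hkl : k = l).
    { assert (Ha : (Rabs (INR k - INR l) < 1)%R) by lra. apply Rabs_def2 in Ha.
      destruct (Nat.lt_trichotomy k l) as [L|[L|L]]; [exfalso | exact L | exfalso];
        apply le_INR in L; rewrite S_INR in L; lra. }
    subst l. replace t with (t - x + x) by ring. rewrite Hd. ring.
  - assert (H : locally x (fun t => rgamma ((t + d) / 2) <> 0)).
    { apply (tends_neq_0 _ _ NZ).
      apply (tends_comp _ (fun t => (t + d) / 2) rgamma ((x + d) / 2));
        [ | apply rgamma_continuous].
      apply tends_mult; [ | apply tends_const].
      apply tends_plus; [apply tends_id | apply tends_const]. }
    apply filter_imp with (2 := H). intros t Ht _. exact Ht.
Qed.

Section GammaQuotient.

Variables alpha beta : C.

Definition rgamma_minus (x : C) : C :=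
  rgamma ((1 + x - alpha) / 2) * rgamma ((1 + x - beta) / 2)
  * rgamma ((1 + x - (1 - alpha - beta)) / 2).

Definition rgamma_plus (x : C) : C :=
  rgamma ((1 + x + alpha) / 2) * rgamma ((1 + x + beta) / 2)
  * rgamma ((1 + x + (1 - alpha - beta)) / 2).

Lemma Gamma_arguments (x : C) :
  (x + alpha + beta) / 2 = (1 + x - (1 - alpha - beta)) / 2 /\
  (x - alpha - beta + 2) / 2 = (1 + x + (1 - alpha - beta)) / 2 /\
  (x - alpha + 1) / 2 = (1 + x - alpha) / 2 /\
  (x - beta + 1) / 2 = (1 + x - beta) / 2 /\
  (x + alpha + 1) / 2 = (1 + x + alpha) / 2 /\
  (x + beta + 1) / 2 = (1 + x + beta) / 2.
Proof. repeat split; field. Qed.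

Lemma regular_iff (x : C) :
  Gamma_quotient_regular alpha beta x <-> rgamma_minus x <> 0 /\ rgamma_plus x <> 0.
Proof.
  unfold Gamma_quotient_regular, rgamma_minus, rgamma_plus.
  destruct (Gamma_arguments x) as [E1 [E2 [E3 [E4 [E5 E6]]]]].
  rewrite !Cmult_3_neq_0, !rgamma_neq_0_iff, E1, E2, E3, E4, E5, E6. tauto.
Qed.

Lemma Gamma_quotient_rgamma (x : C) : Gamma_quotient_regular alpha beta x ->
  Gamma_quotient alpha beta x = rgamma_plus x / rgamma_minus x.
Proof.
  intros H. pose proof (proj1 (regular_iff x) H) as [Hm Hp].
  unfold rgamma_minus, rgamma_plus in *. rewrite Cmult_3_neq_0 in Hm, Hp.
  unfold Gamma_quotient. destruct H as [P1 [P2 [P3 [P4 [P5 P6]]]]].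
  rewrite !Gamma_inv_rgamma by assumption.
  destruct (Gamma_arguments x) as [E1 [E2 [E3 [E4 [E5 E6]]]]].
  rewrite E1, E2, E3, E4, E5, E6. field. tauto.
Qed.

Lemma regular_nearby (x : C) :
  locally' x (fun t => Gamma_quotient_regular alpha beta t).
Proof.
  assert (H : forall d e, (forall t, (t + d) / 2 = e t) ->
            locally' x (fun t => rgamma (e t) <> 0)).
  { intros d e He. apply filter_imp with (2 := rgamma_neq_0_nearby x d).
    intros t. now rewrite He. }
  assert (Hall : locally' x (fun t => rgamma_minus t <> 0 /\ rgamma_plus t <> 0)).
  { unfold rgamma_minus, rgamma_plus.
    pose proof (H (1 - alpha) (fun t => (1 + t - alpha) / 2) ltac:(intros; cbv beta; field)) as H1.
    pose proof (H (1 - beta) (fun t => (1 + t - beta) / 2) ltac:(intros; cbv beta; field)) as H2.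
    pose proof (H (alpha + beta) (fun t => (1 + t - (1 - alpha - beta)) / 2)
                  ltac:(intros; cbv beta; field)) as H3.
    pose proof (H (1 + alpha) (fun t => (1 + t + alpha) / 2) ltac:(intros; cbv beta; field)) as H4.
    pose proof (H (1 + beta) (fun t => (1 + t + beta) / 2) ltac:(intros; cbv beta; field)) as H5.
    pose proof (H (2 - alpha - beta) (fun t => (1 + t + (1 - alpha - beta)) / 2)
                  ltac:(intros; cbv beta; field)) as H6.
    apply filter_imp with
      (2 := filter_and _ _ H1 (filter_and _ _ H2 (filter_and _ _ H3
              (filter_and _ _ H4 (filter_and _ _ H5 H6))))).
    intros t Ht. rewrite !Cmult_3_neq_0. tauto. }
  apply filter_imp with (2 := Hall). intros t. now rewrite regular_iff.
Qed.

Lemma rgamma_half_continuous (x d : C) :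
  tends (locally x) (fun t => rgamma ((1 + t + d) / 2)) (rgamma ((1 + x + d) / 2)).
Proof.
  apply (tends_comp _ (fun t => (1 + t + d) / 2) rgamma ((1 + x + d) / 2));
    [ | apply rgamma_continuous].
  apply tends_mult; [ | apply tends_const]. apply tends_plus; [ | apply tends_const].
  apply tends_plus; [apply tends_const | apply tends_id].
Qed.

Lemma rgamma_minus_continuous (x : C) : tends (locally x) rgamma_minus (rgamma_minus x).
Proof.
  unfold rgamma_minus. repeat apply tends_mult.
  - exact (rgamma_half_continuous x (- alpha)).
  - exact (rgamma_half_continuous x (- beta)).
  - exact (rgamma_half_continuous x (- (1 - alpha - beta))).
Qed.

Lemma rgamma_plus_continuous (x : C) : tends (locally x) rgamma_plus (rgamma_plus x).
Proof.
  unfold rgamma_plus. repeat apply tends_mult; apply rgamma_half_continuous.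
Qed.

(** A continuous representation f/g of the quotient near x without common zero
    at x gives its value at x, finite or not. *)
Lemma Gamma_quotient_value (f g : C -> C) (x : C) :
  tends (locally x) f (f x) -> tends (locally x) g (g x) -> ~ (f x = 0 /\ g x = 0) ->
  locally x (fun t => g t * rgamma_plus t = f t * rgamma_minus t) ->
  locally' x (fun t => ~ (f t = 0 /\ g t = 0)) ->
  is_Gamma_quotient_value alpha beta x (frac (f x) (g x)).
Proof.
  intros Hf Hg Hfg HE Hnz. split.
  - intros Hr. rewrite (Gamma_quotient_rgamma x Hr).
    apply regular_iff in Hr. destruct Hr as [Hm Hp].
    rewrite <- frac_Fin by exact Hm. apply frac_cross; [exact Hfg | tauto | ].
    rewrite (Cmult_comm (rgamma_plus x)). symmetry. exact (locally_singleton _ _ HE).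
  - apply filterlim_ext_loc with (fun t => frac (f t) (g t)).
    + assert (HE' : locally' x (fun t => g t * rgamma_plus t = f t * rgamma_minus t)).
      { apply filter_imp with (2 := HE). intros t Ht _. exact Ht. }
      apply filter_imp with
        (2 := filter_and _ _ (regular_nearby x) (filter_and _ _ HE' Hnz)).
      intros t [Hr [E Hn]]. rewrite (Gamma_quotient_rgamma t Hr).
      apply regular_iff in Hr. destruct Hr as [Hm Hp].
      rewrite <- frac_Fin by exact Hm. apply frac_cross; [exact Hn | tauto | ].
      rewrite (Cmult_comm (rgamma_plus t)). now symmetry.
    + apply (@frac_tends _ (locally' x) (locally'_filter x)); [exact Hfg | | ].
      * apply (tends_le (locally x)); [ | exact Hf].
        intros P HP. apply filter_imp with (2 := HP). intros t Ht _. exact Ht.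
      * apply (tends_le (locally x)); [ | exact Hg].
        intros P HP. apply filter_imp with (2 := HP). intros t Ht _. exact Ht.
Qed.

End GammaQuotient.

(** * Value of the continued fraction *)

Section Value.

Variables alpha beta : C.
Variable kappa : nat -> C.
Let gamma : C := 1 - alpha - beta.

Hypothesis kappa_odd : forall m : nat,
  kappa (2 * m + 1)%nat =
    (2 * INR m + 1 - alpha) * (2 * INR m + 1 - beta) * (2 * INR m + 1 - gamma)
    / (4 * (2 * INR m + 1)).
Hypothesis kappa_even : forall m : nat,
  kappa (2 * m + 2)%nat =
    (2 * INR m + 1 + alpha) * (2 * INR m + 1 + beta) * (2 * INR m + 1 + gamma)
    / (4 * (2 * INR m + 1)).

Let sum_1 : alpha + beta + gamma = 1.
Proof. unfold gamma. ring. Qed.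

Let E : R := coeff_error alpha beta gamma.

Let kappa_near : forall n, (1 <= n)%nat ->
  (Cmod (4 * kappa n - INR n * (INR n - 1)) <= E)%R.
Proof. exact (coefficient_near alpha beta gamma sum_1 kappa kappa_odd kappa_even). Qed.

Lemma is_cf_frac (x p q : C) (f g : nat -> C) :
  ~ (p = 0 /\ q = 0) -> tends eventually f p -> tends eventually g q ->
  eventually (fun n => cf_approximant kappa (cf_b x) n = frac (f n) (g n)) ->
  is_cf kappa (cf_b x) (frac p q).
Proof.
  intros H Hf Hg HE. unfold is_cf.
  apply filterlim_ext_loc with (fun n => frac (f n) (g n)).
  - apply filter_imp with (2 := HE). intros n En. now symmetry.
  - apply (frac_tends eventually); assumption.
Qed.

Lemma sphere_div_1_frac (p q : C) : ~ (p = 0 /\ q = 0) ->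
  sphere_div 1 (frac p q) = frac q p.
Proof.
  intros H. rewrite sphere_div_frac by (exact H || apply C1_nz). f_equal. ring.
Qed.

Lemma far_threshold (x : C) : (1 + Rabs E <= Re x)%R ->
  (0 < Re x)%R /\ (E <= Re x * Re x)%R /\ (Cmod (kappa 1) / (Re x / 2) <= 2 * Cmod (kappa 1))%R.
Proof.
  intros Hx. pose proof (Rabs_pos E). pose proof (RRle_abs E).
  assert (Hp : (0 < Re x)%R) by lra. split; [exact Hp | ]. split; [nra | ].
  pose proof (Cmod_ge_0 (kappa 1)). apply Rle_div_l; nra.
Qed.

Section Terminating.

Variable M : nat.
Hypothesis M_pos : (1 <= M)%nat.
Hypothesis kappa_M : kappa M = 0.
Hypothesis kappa_before_M : forall i, (1 <= i < M)%nat -> kappa i <> 0.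

Let U (x : C) : C := cf_num kappa x M.
Let V (x : C) : C := cf_den kappa x M.

Let UV_neq_0 (x : C) : ~ (U x = 0 /\ V x = 0).
Proof.
  unfold U, V. destruct M as [|m]; [lia | ].
  apply cf_num_den_neq_0. intros i Hi. apply kappa_before_M. lia.
Qed.

(** After the zero coefficient a solution is determined by its value at M, so
    the Bauer-Muir transformation multiplies that value by a factor common to
    all solutions. *)
Let shifted_at_M (x : C) : exists G, forall u v,
  shifted alpha beta gamma x (solution kappa x u v) M = G * solution kappa x u v M.
Proof.
  destruct M as [|m] eqn:EM; [lia | ]. rewrite <- EM in *.
  exists (x * x + kappa (S M) + modifier alpha beta gamma x (S M) * x
     - (x + 2 - modifier alpha beta gamma (- (x + 2)) (S M))
       * (x + modifier alpha beta gamma x M)).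
  intros u v. unfold shifted.
  assert (E1 : solution kappa x u v (S M) = x * solution kappa x u v M).
  { rewrite EM at 1. rewrite solution_SS, <- EM, kappa_M. ring. }
  rewrite (solution_SS _ _ _ _ M), E1. ring.
Qed.

Let UV_shift_generic (x : C) : 1 + x <> 0 ->
  U (x + 2) * V x * ((1 + x - alpha) / 2 * ((1 + x - beta) / 2) * ((1 + x - gamma) / 2)) =
  U x * V (x + 2) * ((1 + x + alpha) / 2 * ((1 + x + beta) / 2) * ((1 + x + gamma) / 2)).
Proof.
  intros Hx. destruct (shifted_at_M x) as [G HG].
  pose proof (shifted_num alpha beta gamma sum_1 kappa kappa_odd kappa_even x M Hx) as HU.
  pose proof (shifted_den alpha beta gamma sum_1 kappa kappa_odd kappa_even x M Hx) as HV.
  unfold cf_num at 1 in HU. unfold cf_den at 1 in HV. rewrite HG in HU, HV.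
  rewrite defect_reflected in HV by exact Hx. unfold defect in HU.
  fold (cf_num kappa x) in HU. fold (cf_den kappa x) in HV.
  fold (U (x + 2)) in HU. fold (V (x + 2)) in HV.
  fold (U x) in HU. fold (V x) in HV.
  transitivity (G * U x * V x * ((1 + x) / 2)).
  - rewrite HU. field. exact Hx.
  - replace (G * U x * V x * ((1 + x) / 2)) with (U x * (G * V x) * ((1 + x) / 2)) by ring.
    rewrite HV. field. exact Hx.
Qed.

(** Both sides are polynomials in x, so the exception at x = -1 disappears. *)
Let UV_shift (x : C) :
  U (x + 2) * V x * ((1 + x - alpha) / 2 * ((1 + x - beta) / 2) * ((1 + x - gamma) / 2)) =
  U x * V (x + 2) * ((1 + x + alpha) / 2 * ((1 + x + beta) / 2) * ((1 + x + gamma) / 2)).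
Proof.
  set (f := fun x =>
    U (x + 2) * V x * ((1 + x - alpha) / 2 * ((1 + x - beta) / 2) * ((1 + x - gamma) / 2)) -
    U x * V (x + 2) * ((1 + x + alpha) / 2 * ((1 + x + beta) / 2) * ((1 + x + gamma) / 2))).
  enough (Hf : f x = 0).
  { unfold f in Hf.
    match goal with |- ?p = ?q => replace p with (p - q + q) by ring end.
    rewrite Hf. ring. }
  destruct (Ceq_dec (f x) 0) as [Z|NZ]; [exact Z | exfalso].
  assert (Hc : tends (locally x) f (f x)).
  { assert (H2 : tends (locally x) (fun t => t + 2) (x + 2))
      by (apply tends_plus; [apply tends_id | apply tends_const]).
    assert (Haff : forall d, tends (locally x) (fun t => (1 + t + d) / 2) ((1 + x + d) / 2)).
    { intros d. apply tends_mult; [ | apply tends_const].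
      apply tends_plus; [ | apply tends_const].
      apply tends_plus; [apply tends_const | apply tends_id]. }
    assert (HU2 : tends (locally x) (fun t => U (t + 2)) (U (x + 2))).
    { apply (tends_comp _ (fun t => t + 2) U (x + 2) _ H2). apply cf_num_continuous. }
    assert (HV2 : tends (locally x) (fun t => V (t + 2)) (V (x + 2))).
    { apply (tends_comp _ (fun t => t + 2) V (x + 2) _ H2). apply cf_den_continuous. }
    unfold f. apply tends_minus.
    - apply tends_mult.
      + apply tends_mult; [exact HU2 | apply cf_den_continuous].
      + apply tends_mult; [apply tends_mult | ];
          [apply (Haff (- alpha)) | apply (Haff (- beta)) | apply (Haff (- gamma))].
    - apply tends_mult.
      + apply tends_mult; [apply cf_num_continuous | exact HV2].
      + apply tends_mult; [apply tends_mult | ]; apply Haff. }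
  destruct (proj1 (locally_Cmod _ _) (tends_neq_0 _ _ NZ Hc)) as [eps [Heps He]].
  assert (Hgen : forall t, 1 + t <> 0 -> f t = 0).
  { intros t Ht. unfold f. rewrite (UV_shift_generic t Ht). ring. }
  destruct (Ceq_dec (1 + x) 0) as [Hx|Hx]; [ | now apply NZ, Hgen].
  apply (He (x + (eps / 2)%R)).
  - replace (x + (eps / 2)%R - x) with (RtoC (eps / 2)) by ring.
    rewrite Cmod_R, Rabs_pos_eq by lra. lra.
  - apply Hgen. replace (1 + (x + (eps / 2)%R)) with (1 + x + (eps / 2)%R) by ring.
    rewrite Hx. replace (0 + (eps / 2)%R) with (RtoC (eps / 2)) by ring.
    intros Z. apply RtoC_inj in Z. lra.
Qed.

Let UV_far (x : C) : (1 + Rabs E <= Re x)%R ->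
  (Cmod (U x - x / 2 * V x) <= 2 * Cmod (kappa 1) * Cmod (V x))%R.
Proof.
  intros Hx. destruct (far_threshold x Hx) as [H1 [H2 H3]].
  unfold U, V. destruct M as [|m]; [lia | ].
  eapply Rle_trans; [apply (cf_near_half kappa E kappa_near x m H1 H2) | ].
  apply Rmult_le_compat_r; [apply Cmod_ge_0 | exact H3].
Qed.

Lemma terminating_value (x : C) : exists w : sphere,
  is_cf kappa (cf_b x) w /\ is_Gamma_quotient_value alpha beta x (sphere_div 1 w).
Proof.
  exists (frac (U x) (V x)). split.
  - apply is_cf_frac with (fun _ => U x) (fun _ => V x);
      [apply UV_neq_0 | apply tends_const | apply tends_const | ].
    exists (M - 1)%nat. intros n Hn. unfold cf_approximant.
    rewrite (cf_K_truncated kappa (cf_b x) (M - 1) 0 n Hn);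
      [ | now replace (S (0 + (M - 1))) with M by lia].
    fold (cf_approximant kappa (cf_b x) (M - 1)).
    rewrite cf_approximant_frac; [ | intros i Hi; apply kappa_before_M; lia].
    now replace (S (M - 1)) with M by lia.
  - rewrite sphere_div_1_frac by apply UV_neq_0.
    apply Gamma_quotient_value.
    + apply cf_den_continuous.
    + apply cf_num_continuous.
    + intros [H1 H2]. now apply (UV_neq_0 x).
    + apply filter_forall. intros t. unfold rgamma_plus, rgamma_minus.
      apply (Gamma_factors alpha beta gamma sum_1 U V (fun _ => True)
               (fun _ _ => I) (fun y _ => UV_neq_0 y) (fun y _ => UV_shift y)
               (1 + Rabs E)%R (2 * Cmod (kappa 1))%R (fun y _ => UV_far y) t I).
    + apply filter_forall. intros t [H1 H2]. now apply (UV_neq_0 t).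
Qed.

End Terminating.

(** The three parity conditions are one: an odd value among alpha, beta and
    gamma makes a coefficient vanish, at an odd or an even place according to
    its sign. *)
Lemma kappa_zero (d : C) : d = alpha \/ d = beta \/ d = gamma -> odd_integer d ->
  exists n, (1 <= n)%nat /\ kappa n = 0.
Proof.
  intros Hd [k Hk]. destruct (Z_le_gt_dec 0 k) as [L|L].
  - exists (2 * Z.to_nat k + 1)%nat. split; [lia | ]. rewrite kappa_odd.
    assert (Z : 2 * INR (Z.to_nat k) + 1 - d = 0).
    { rewrite Hk, INR_IZR_INZ, Z2Nat.id by lia.
      rewrite plus_IZR, mult_IZR, RtoC_plus, RtoC_mult. ring. }
    destruct Hd as [-> | [-> | ->]]; rewrite Z; unfold Cdiv; ring.
  - exists (2 * Z.to_nat (- k - 1) + 2)%nat. split; [lia | ]. rewrite kappa_even.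
    assert (Z : 2 * INR (Z.to_nat (- k - 1)) + 1 + d = 0).
    { rewrite Hk, INR_IZR_INZ, Z2Nat.id by lia.
      replace (IZR (- k - 1)) with (- IZR k - 1)%R by (rewrite minus_IZR, opp_IZR; ring).
      rewrite plus_IZR, mult_IZR, RtoC_minus, RtoC_opp, RtoC_plus, RtoC_mult. ring. }
    destruct Hd as [-> | [-> | ->]]; rewrite Z; unfold Cdiv; ring.
Qed.

Section NonTerminating.

Hypothesis kappa_neq_0 : forall n, (1 <= n)%nat -> kappa n <> 0.

Let not_odd (d : C) : d = alpha \/ d = beta \/ d = gamma -> ~ odd_integer d.
Proof.
  intros Hd Ho. destruct (kappa_zero d Hd Ho) as [n [Hn Z]]. now apply (kappa_neq_0 n Hn).
Qed.

Let odd_of_poles (x d e f : C) (k l : nat) : d + e + f = 1 ->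
  (1 + x - d) / 2 = - INR k -> (1 + x + e) / 2 = - INR l -> odd_integer f.
Proof.
  intros Hs H1 H2. exists (Z.of_nat l - Z.of_nat k)%Z.
  rewrite plus_IZR, mult_IZR, minus_IZR, <- !INR_IZR_INZ.
  rewrite RtoC_plus, RtoC_mult, RtoC_minus.
  replace f with (1 - 2 * ((1 + x + e) / 2 - (1 + x - d) / 2)).
  - rewrite H1, H2. ring.
  - transitivity (1 - (d + e)); [field | ]. rewrite <- Hs. ring.
Qed.

Let opposite_poles (x d : C) (k l : nat) :
  (0 < Re x)%R -> (1 + x - d) / 2 = - INR k -> (1 + x + d) / 2 = - INR l -> False.
Proof.
  intros Hx H1 H2.
  assert (H : x = (- INR k - INR l - 1)%R).
  { replace x with ((1 + x - d) / 2 + (1 + x + d) / 2 - 1) by field.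
    rewrite H1, H2, !RtoC_minus, RtoC_opp. ring. }
  rewrite H in Hx. simpl in Hx. pose proof (pos_INR k). pose proof (pos_INR l). lra.
Qed.

(** Common zeros of the two products of reciprocal Gamma factors come from
    vanishing coefficients, or lie in the left half plane. *)
Let rgamma_products_neq_0 (x : C) : (0 < Re x)%R ->
  ~ (rgamma_plus alpha beta x = 0 /\ rgamma_minus alpha beta x = 0).
Proof.
  intros Hx [Hp Hm]. unfold rgamma_plus, rgamma_minus in *. fold gamma in Hp, Hm.
  assert (Hpole : forall z, rgamma z = 0 -> exists k : nat, z = - INR k).
  { intros z Hz. apply NNPP. intros N. now apply (rgamma_neq_0 z N). }
  assert (Hcases : forall z1 z2 z3, rgamma z1 * rgamma z2 * rgamma z3 = 0 ->
            exists k : nat, z1 = - INR k \/ z2 = - INR k \/ z3 = - INR k).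
  { intros z1 z2 z3 Hz. apply Cmult_eq_0 in Hz. destruct Hz as [Hz|Hz].
    - apply Cmult_eq_0 in Hz.
      destruct Hz as [Hz|Hz]; destruct (Hpole _ Hz) as [k Hk]; exists k; tauto.
    - destruct (Hpole _ Hz) as [k Hk]; exists k; tauto. }
  apply Hcases in Hp, Hm. destruct Hp as [l Hp]. destruct Hm as [k Hm].
  assert (Na : ~ odd_integer alpha) by (apply not_odd; tauto).
  assert (Nb : ~ odd_integer beta) by (apply not_odd; tauto).
  assert (Nc : ~ odd_integer gamma) by (apply not_odd; tauto).
  assert (S2 : alpha + gamma + beta = 1) by (rewrite <- sum_1; ring).
  assert (S3 : beta + alpha + gamma = 1) by (rewrite <- sum_1; ring).
  assert (S4 : beta + gamma + alpha = 1) by (rewrite <- sum_1; ring).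
  assert (S5 : gamma + alpha + beta = 1) by (rewrite <- sum_1; ring).
  assert (S6 : gamma + beta + alpha = 1) by (rewrite <- sum_1; ring).
  destruct Hm as [Hm | [Hm | Hm]]; destruct Hp as [Hp | [Hp | Hp]];
    first [ exact (opposite_poles _ _ _ _ Hx Hm Hp)
          | apply Na; eapply odd_of_poles; [ | exact Hm | exact Hp]; assumption
          | apply Nb; eapply odd_of_poles; [ | exact Hm | exact Hp]; assumption
          | apply Nc; eapply odd_of_poles; [ | exact Hm | exact Hp]; assumption ].
Qed.

Let U (x : C) : C := climit (fun n => cf_num kappa x (S n) / growth x n).
Let V (x : C) : C := climit (fun n => cf_den kappa x (S n) / growth x n).

Let UV_limits (x : C) : (0 < Re x)%R ->
  tends eventually (fun n => cf_num kappa x (S n) / growth x n) (U x) /\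
  tends eventually (fun n => cf_den kappa x (S n) / growth x n) (V x) /\
  ~ (U x = 0 /\ V x = 0).
Proof.
  intros Hx. destruct (normalized_limits kappa E x kappa_near Hx) as [u [v [Hu [Hv Huv]]]].
  assert (EU : U x = u) by (apply tends_climit; exact Hu).
  assert (EV : V x = v) by (apply tends_climit; exact Hv).
  rewrite EU, EV. auto.
Qed.

Let Re_shift (x : C) : (0 < Re x)%R -> (0 < Re (x + 2))%R.
Proof. intros H. change (Re (x + 2)) with (Re x + 2)%R. lra. Qed.

Let UV_shift (x : C) : (0 < Re x)%R ->
  U (x + 2) * V x * ((1 + x - alpha) / 2 * ((1 + x - beta) / 2) * ((1 + x - gamma) / 2)) =
  U x * V (x + 2) * ((1 + x + alpha) / 2 * ((1 + x + beta) / 2) * ((1 + x + gamma) / 2)).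
Proof.
  intros Hx. destruct (UV_limits x Hx) as [HU [HV _]].
  destruct (UV_limits (x + 2) (Re_shift x Hx)) as [HU2 [HV2 _]].
  assert (H1x : 1 + x <> 0).
  { pose proof (add_INR_neq_0 x Hx 1) as N. simpl in N. now rewrite Cplus_comm. }
  pose proof (shifted_limit x Hx alpha beta gamma _ _ HU) as LU.
  pose proof (shifted_limit x Hx alpha beta gamma _ _ HV) as LV.
  assert (EU : (1 + x) * (2 + x) * U x = defect alpha beta gamma x * U (x + 2)).
  { refine (tends_unique _ _ _ LU _).
    apply tends_ext with (fun n => defect alpha beta gamma x
                                   * (cf_num kappa (x + 2) (S n) / growth (x + 2) n)).
    - intros n. rewrite (shifted_num alpha beta gamma sum_1 kappa kappa_odd kappa_even)
        by exact H1x. unfold Cdiv. ring.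
    - apply tends_mult; [apply tends_const | exact HU2]. }
  assert (EV : (1 + x) * (2 + x) * V x = defect alpha beta gamma (- (x + 2)) * V (x + 2)).
  { refine (tends_unique _ _ _ LV _).
    apply tends_ext with (fun n => defect alpha beta gamma (- (x + 2))
                                   * (cf_den kappa (x + 2) (S n) / growth (x + 2) n)).
    - intros n. rewrite (shifted_den alpha beta gamma sum_1 kappa kappa_odd kappa_even)
        by exact H1x. unfold Cdiv. ring.
    - apply tends_mult; [apply tends_const | exact HV2]. }
  rewrite defect_reflected in EV by exact H1x. unfold defect in EU.
  transitivity (((1 + x) * (2 + x) * U x) * V x * ((1 + x) / 2)).
  - rewrite EU. field. exact H1x.
  - replace ((1 + x) * (2 + x) * U x * V x * ((1 + x) / 2))
      with (U x * ((1 + x) * (2 + x) * V x) * ((1 + x) / 2)) by ring.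
    rewrite EV. field. exact H1x.
Qed.

Let UV_far (x : C) : (0 < Re x)%R -> (1 + Rabs E <= Re x)%R ->
  (Cmod (U x - x / 2 * V x) <= 2 * Cmod (kappa 1) * Cmod (V x))%R.
Proof.
  intros Hx0 Hx. destruct (far_threshold x Hx) as [H1 [H2 H3]].
  destruct (UV_limits x Hx0) as [HU [HV _]].
  apply (tends_Cmod_le _ _ _ _ _
    (tends_minus _ _ _ _ HU (tends_mult _ _ _ _ (tends_const (x / 2)) HV)) HV).
  - pose proof (Cmod_ge_0 (kappa 1)). lra.
  - apply filter_forall. intros n. pose proof (growth_neq_0 x Hx0 n) as Hg.
    replace (cf_num kappa x (S n) / growth x n - x / 2 * (cf_den kappa x (S n) / growth x n))
      with ((cf_num kappa x (S n) - x / 2 * cf_den kappa x (S n)) / growth x n)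
      by (field; exact Hg).
    rewrite !Cmod_div by exact Hg. unfold Rdiv. rewrite <- Rmult_assoc.
    apply Rmult_le_compat_r.
    + left. now apply Rinv_0_lt_compat, Cmod_gt_0.
    + eapply Rle_trans; [apply (cf_near_half kappa E kappa_near x n H1 H2) | ].
      apply Rmult_le_compat_r; [apply Cmod_ge_0 | exact H3].
Qed.

Lemma nonterminating_value (x : C) : (0 < Re x)%R -> exists w : sphere,
  is_cf kappa (cf_b x) w /\ is_Gamma_quotient_value alpha beta x (sphere_div 1 w).
Proof.
  intros Hx. destruct (UV_limits x Hx) as [HU [HV Hnz]].
  exists (frac (U x) (V x)). split.
  - apply (is_cf_frac x _ _ _ _ Hnz HU HV). apply filter_forall. intros n.
    rewrite cf_approximant_frac by (intros i Hi; apply kappa_neq_0; lia).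
    pose proof (growth_neq_0 x Hx n) as Hg.
    pose proof (cf_num_den_neq_0 kappa x n ltac:(intros i Hi; apply kappa_neq_0; lia)) as Hn.
    apply frac_cross; [exact Hn | | field; exact Hg].
    intros [E1 E2]. apply Hn. split.
    + replace (cf_num kappa x (S n)) with (cf_num kappa x (S n) / growth x n * growth x n)
        by (field; exact Hg). rewrite E1. ring.
    + replace (cf_den kappa x (S n)) with (cf_den kappa x (S n) / growth x n * growth x n)
        by (field; exact Hg). rewrite E2. ring.
  - rewrite sphere_div_1_frac by exact Hnz.
    pose proof (Gamma_factors alpha beta gamma sum_1 U V (fun y => 0 < Re y)%R
      Re_shift (fun y Hy => proj2 (proj2 (UV_limits y Hy))) UV_shift
      (1 + Rabs E)%R (2 * Cmod (kappa 1))%R UV_far x Hx) as HG.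
    fold gamma in HG.
    replace (frac (V x) (U x)) with (frac (rgamma_plus alpha beta x) (rgamma_minus alpha beta x)).
    2:{ apply frac_cross; [now apply rgamma_products_neq_0 | tauto | ].
        rewrite (Cmult_comm (rgamma_plus alpha beta x)). exact HG. }
    apply Gamma_quotient_value.
    + apply rgamma_plus_continuous.
    + apply rgamma_minus_continuous.
    + now apply rgamma_products_neq_0.
    + apply filter_forall. intros t. ring.
    + apply filter_imp with (2 := regular_nearby alpha beta x). intros t Ht [Z _].
      apply regular_iff in Ht. tauto.
Qed.

End NonTerminating.

End Value.

Local Close Scope C_scope.

Theorem theorem1p2 (x alpha beta : C) (kappa : nat -> C)
  (Hx : (0 < Re x)%R \/
        (odd_integer alpha \/ odd_integer beta) \/ even_integer (alpha + beta)%C)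
  (Hkappa_even : forall m : nat, (1 <= m)%nat ->
    kappa (2 * m)%nat =
      ((2 * INR m - alpha - beta) * (2 * INR m - 1 + alpha) *
       (2 * INR m - 1 + beta) / (4 * (2 * INR m - 1)))%C)
  (Hkappa_odd : forall m : nat, (1 <= m)%nat ->
    kappa (2 * m - 1)%nat =
      ((2 * INR m - 2 + alpha + beta) * (2 * INR m - 1 - alpha) *
       (2 * INR m - 1 - beta) / (4 * (2 * INR m - 1)))%C) :
  exists w : sphere,
    is_cf kappa (fun n => match n with O => (x / 2)%C | S _ => x end) w /\
    is_Gamma_quotient_value alpha beta x (sphere_div 1 w).
Proof.
  assert (Ho : forall m : nat, kappa (2 * m + 1)%nat =
    ((2 * INR m + 1 - alpha) * (2 * INR m + 1 - beta) * (2 * INR m + 1 - (1 - alpha - beta))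
     / (4 * (2 * INR m + 1)))%C).
  { intros m. replace (2 * m + 1)%nat with (2 * S m - 1)%nat by lia.
    rewrite Hkappa_odd, RtoC_INR_S by lia.
    replace (2 * (INR m + 1) - 1)%C with (2 * INR m + 1)%C by ring.
    unfold Cdiv. ring. }
  assert (He : forall m : nat, kappa (2 * m + 2)%nat =
    ((2 * INR m + 1 + alpha) * (2 * INR m + 1 + beta) * (2 * INR m + 1 + (1 - alpha - beta))
     / (4 * (2 * INR m + 1)))%C).
  { intros m. replace (2 * m + 2)%nat with (2 * S m)%nat by lia.
    rewrite Hkappa_even, RtoC_INR_S by lia.
    replace (2 * (INR m + 1) - 1)%C with (2 * INR m + 1)%C by ring.
    unfold Cdiv. ring. }
  change (fun n => match n with O => (x / 2)%C | S _ => x end) with (cf_b x).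
  destruct (classic (exists n, (1 <= n)%nat /\ kappa n = RtoC 0)) as [Hz|Hnz].
  - destruct (dec_inh_nat_subset_has_unique_least_element
      (fun n => (1 <= n)%nat /\ kappa n = RtoC 0) (fun n => classic _) Hz)
      as [M [[[HM1 HM2] Hmin] _]].
    apply (terminating_value alpha beta kappa Ho He M HM1 HM2).
    intros i Hi Z. pose proof (Hmin i (conj (proj1 Hi) Z)). lia.
  - apply (nonterminating_value alpha beta kappa Ho He).
    + intros n Hn Z. apply Hnz. now exists n.
    + destruct Hx as [Hx | Hx]; [exact Hx | exfalso; apply Hnz].
      destruct Hx as [[Hx | Hx] | Hx].
      * now apply (kappa_zero alpha beta kappa Ho He alpha); [left | ].
      * now apply (kappa_zero alpha beta kappa Ho He beta); [right; left | ].
      * apply (kappa_zero alpha beta kappa Ho He (1 - alpha - beta)%C); [now right; right | ].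
        destruct Hx as [k Hk]. exists (- k)%Z.
        replace (1 - alpha - beta)%C with (1 - (alpha + beta))%C by ring.
        rewrite Hk, plus_IZR, !mult_IZR, opp_IZR, RtoC_plus, !RtoC_mult, RtoC_opp. ring.
Qed.
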